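(* Let $\{A(t,\varphi): t\in\mathbb R,\varphi\in E\}$ be a family of m-dissipative operators in $X$, and suppose that either (i) $A$ satisfies the uniformly continuous control condition with data $(h,k,K_0,L_1,L_2)$ and $K_0<-\omega$, or (ii) $A$ satisfies the Lipschitz control condition with data $(g,h,k,K_0,L_1,L_2)$ and $\max\{K_0,L_g\}<-\omega$, where $L_g$ is the Lipschitz constant of $g$. Suppose further that for some $T>0$, $$A(t+T,\varphi)=A(t,\varphi)\quad\text{for all }t\in\mathbb R,\ \varphi\in E.$$ Then there exists a $T$-periodic solution $u:\mathbb R\to X$ of $$u'(t)\in A(t,u_t)u(t)+\omega u(t),\quad t\in\mathbb R.$$
   Context: $X$ is a Banach space, $\omega\in\mathbb R$, $\mathbb R^+=[0,\infty)$. $BUC(J,X)$ denotes the bounded uniformly continuous functions $J\to X$ with the sup norm. Either (infinite delay) $\mathbb I=(-\infty,0]$ and $E=BUC((-\infty,0],X)$, or (finite delay) $\mathbb I=[-r,0]$ for some $r>0$ and $E=C([-r,0],X)$; $E$ carries the sup norm $\|\cdot\|_E$. For $u\in BUC(\mathbb R,X)$ and $t\in\mathbb R$, $u_t\in E$ is $u_t(s)=u(t+s)$, $s\in\mathbb I$. The operators $A(t,\varphi)\subset X\times X$ may be multivalued, with domain depending on $(t,\varphi)$; m-dissipative means dissipative with $R(I-\lambda A(t,\varphi))=X$ for all $\lambda>0$. Uniformly continuous control condition with data $(h,k,K_0,L_1,L_2)$: $h,k:\mathbb R\to X$ are bounded and uniformly continuous, $K_0>0$, $L_1,L_2:\mathbb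 R^+\to\mathbb R^+$ are continuous and non-decreasing, and for all $\lambda>0$, $t_1,t_2\in\mathbb R$, $\varphi_1,\varphi_2\in E$, $[x_i,y_i]\in A(t_i,\varphi_i)$ ($i=1,2$), $$\|x_1-x_2\|\le\|x_1-x_2-\lambda(y_1-y_2)\|+\lambda\|h(t_1)-h(t_2)\|L_1(\|x_2\|)+\lambda\|k(t_1)-k(t_2)\|L_2(\|\varphi_2\|_E)+K_0\lambda\|\varphi_1-\varphi_2\|_E.$$ Lipschitz control condition with data $(g,h,k,K_0,L_1,L_2)$: $g,h,k:\mathbb R\to X$ are bounded and Lipschitz continuous, $K_0>0$, $L_1,L_2:\mathbb R^+\to\mathbb R^+$ are continuous and non-decreasing, and for all $\lambda>0$, $t_1,t_2\in\mathbb R$, $\varphi_1,\varphi_2\in E$, $[x_i,y_i]\in A(t_i,\varphi_i)$ ($i=1,2$), $$\|x_1-x_2\|\le\|x_1-x_2-\lambda(y_1-y_2)\|+\lambda\|h(t_1)-h(t_2)\|L_1(\|x_2\|)+\lambda\|g(t_1)-g(t_2)\|\,\|y_2\|+\lambda\|k(t_1)-k(t_2)\|L_2(\|\varphi_2\|_E)+K_0\lambda\|\varphi_1-\varphi_2\|_E.$$ Yosida approximation of the derivative: for $\lambda>0$ and $u\in BUC(\mathbb R,X)$, $(\partial_t)_\lambda u(t)=\frac1\lambda\Big(u(t)-\frac1\lambda\int_0^\infty e^{-\tau/\lambda}u(t-\tau)\,d\tau\Big)$. Recursion started at $\psi\in BUC(\mathbb R,X)$: for $\lambda>0$, $u_{1,\lambda}\in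 BUC(\mathbb R,X)$ is the (unique) solution of $(\partial_t)_\lambda u_{1,\lambda}(t)\in A(t,\psi_t)u_{1,\lambda}(t)+\omega u_{1,\lambda}(t)$, $t\in\mathbb R$; given $u_{n,\lambda}$, $u_{n+1,\lambda}\in BUC(\mathbb R,X)$ is the (unique) solution of $(\partial_t)_\lambda u_{n+1,\lambda}(t)\in A(t,(u_{n,\lambda})_t)u_{n+1,\lambda}(t)+\omega u_{n+1,\lambda}(t)$, $t\in\mathbb R$. Solution: $u:\mathbb R\to X$ is called the solution of $u'(t)\in A(t,u_t)u(t)+\omega u(t)$, $t\in\mathbb R$, if for every starting point $\psi\in BUC(\mathbb R,X)$ one has $u=\lim_{n\to\infty}\lim_{\lambda\to0+}u_{n,\lambda}$, both limits existing uniformly on $\mathbb R$. *)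

(* Defs.v *)
From Stdlib Require Import Reals Lra.
From Coquelicot Require Import Coquelicot.

Set Implicit Arguments.
Unset Strict Implicit.
Unset Printing Implicit Defensive.

Open Scope R_scope.

(** A Banach space is a [CompleteNormedModule R_AbsRing]; a complex Banach space
    is covered through its underlying real structure. *)

(** Functions on a subset of the line are functions on a type [S] with a
    projection [p : S -> R]: [S = R] with the identity, or [S = {s | J s}] with
    [proj1_sig]. *)
Section FunctionSpaces.
Context {X : CompleteNormedModule R_AbsRing} {S : Type}.

Definition bounded_fun (f : S -> X) : Prop :=
  exists M : R, forall s, norm (f s) <= M.

Definition continuous_fun (p : S -> R) (f : S -> X) : Prop :=
  forall s (eps : posreal), exists delta : posreal,
    forall s', Rabs (p s' - p s) < delta -> norm (minus (f s') (f s)) < eps.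

Definition unif_continuous_fun (p : S -> R) (f : S -> X) : Prop :=
  forall eps : posreal, exists delta : posreal,
    forall s s', Rabs (p s' - p s) < delta -> norm (minus (f s') (f s)) < eps.

(** The supremum is taken in [Rbar]; it is finite on bounded functions, in
    particular on continuous functions on a compact interval. *)
Definition sup_norm (f : S -> X) : R :=
  real (Lub_Rbar (fun y => exists s, y = norm (f s))).

Definition unif_limit {I : Type} (F : (I -> Prop) -> Prop)
    (f : I -> S -> X) (g : S -> X) : Prop :=
  forall eps : posreal, F (fun i => forall s, norm (minus (f i s) (g s)) < eps).

End FunctionSpaces.

Definition lipschitz_fun {X : CompleteNormedModule R_AbsRing} (f : R -> X) : Prop :=
  exists L : R, forall s t, norm (minus (f s) (f t)) <= L * Rabs (s - t).

(** The least Lipschitz constant. *)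
Definition lipschitz_const {X : CompleteNormedModule R_AbsRing} (f : R -> X) : R :=
  real (Lub_Rbar (fun q => exists s t : R,
    s <> t /\ q = norm (minus (f s) (f t)) / Rabs (s - t))).

Record BUC (X : CompleteNormedModule R_AbsRing) := mkBUC {
  BUC_fun :> R -> X;
  BUC_bounded : bounded_fun BUC_fun;
  BUC_unif_continuous : unif_continuous_fun (fun t : R => t) BUC_fun
}.

Inductive delay : Type :=
| infinite_delay : delay
| finite_delay : posreal -> delay.

Definition delay_interval (d : delay) (s : R) : Prop :=
  match d with
  | infinite_delay => s <= 0
  | finite_delay r => - r <= s <= 0
  end.

(** The history space [E]: [BUC((-oo,0],X)] or [C([-r,0],X)]. *)
Definition history_regular (X : CompleteNormedModule R_AbsRing) (d : delay) :
    ({s : R | delay_interval d s} -> X) -> Prop :=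
  match d with
  | infinite_delay => fun f =>
      bounded_fun f /\ unif_continuous_fun (@proj1_sig R _) f
  | finite_delay _ => fun f => continuous_fun (@proj1_sig R _) f
  end.

Record history (X : CompleteNormedModule R_AbsRing) (d : delay) := mkHistory {
  history_fun :> {s : R | delay_interval d s} -> X;
  history_fun_regular : history_regular history_fun
}.

Lemma segment_regular (X : CompleteNormedModule R_AbsRing) (d : delay)
    (u : BUC X) (t : R) :
  @history_regular X d (fun s => u (t + proj1_sig s)).
Proof.
assert (Huc : forall J : R -> Prop, unif_continuous_fun (@proj1_sig R J)
                (fun s : {s : R | J s} => u (t + proj1_sig s))).
{ intros J eps.
  destruct (BUC_unif_continuous u eps) as [delta Hd].
  exists delta. intros [s Js] [s' Js'] Hs. simpl in *. apply Hd.
  replace (t + s' - (t + s)) with (s' - s) by ring.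
  exact Hs. }
destruct d as [|r]; simpl.
- split; [|apply Huc].
  destruct (BUC_bounded u) as [M HM].
  exists M. intros s. apply HM.
- intros s eps.
  destruct (Huc (fun s => - r <= s <= 0) eps) as [delta Hd].
  exists delta. intros s'. apply Hd.
Qed.

(** [u_t], given by [u_t(s) = u(t + s)]. *)
Definition segment (X : CompleteNormedModule R_AbsRing) (d : delay)
    (u : BUC X) (t : R) : history X d :=
  mkHistory (@segment_regular X d u t).

(** A multivalued operator is given by its graph: [B x y] means [[x,y] in B]. *)
Definition dissipative {X : CompleteNormedModule R_AbsRing}
    (B : X -> X -> Prop) : Prop :=
  forall lambda x1 y1 x2 y2, 0 < lambda -> B x1 y1 -> B x2 y2 ->
    norm (minus x1 x2)
    <= norm (minus (minus x1 x2) (scal lambda (minus y1 y2))).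

Definition m_dissipative {X : CompleteNormedModule R_AbsRing}
    (B : X -> X -> Prop) : Prop :=
  dissipative B /\
  forall lambda, 0 < lambda ->
    forall z : X, exists x y, B x y /\ z = minus x (scal lambda y).

(** [L] represents a continuous non-decreasing function [R^+ -> R^+]; its values
    on negative numbers are irrelevant. *)
Definition control_gauge (L : R -> R) : Prop :=
  (forall s, 0 <= s -> 0 <= L s) /\
  continuous_on (fun s => 0 <= s) L /\
  (forall s t, 0 <= s -> s <= t -> L s <= L t).

Section Equation.
Context {X : CompleteNormedModule R_AbsRing} {d : delay}.
Variable A : R -> history X d -> X -> X -> Prop.

Definition unif_continuous_control (h k : R -> X) (K0 : R) (L1 L2 : R -> R) : Prop :=
  (bounded_fun h /\ unif_continuous_fun (fun t : R => t) h) /\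
  (bounded_fun k /\ unif_continuous_fun (fun t : R => t) k) /\
  0 < K0 /\ control_gauge L1 /\ control_gauge L2 /\
  forall lambda t1 t2 (phi1 phi2 : history X d) x1 y1 x2 y2,
    0 < lambda -> A t1 phi1 x1 y1 -> A t2 phi2 x2 y2 ->
    norm (minus x1 x2)
    <= norm (minus (minus x1 x2) (scal lambda (minus y1 y2)))
       + lambda * norm (minus (h t1) (h t2)) * L1 (norm x2)
       + lambda * norm (minus (k t1) (k t2)) * L2 (sup_norm phi2)
       + K0 * lambda * sup_norm (fun s => minus (phi1 s) (phi2 s)).

Definition lipschitz_control (g h k : R -> X) (K0 : R) (L1 L2 : R -> R) : Prop :=
  (bounded_fun g /\ lipschitz_fun g) /\
  (bounded_fun h /\ lipschitz_fun h) /\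
  (bounded_fun k /\ lipschitz_fun k) /\
  0 < K0 /\ control_gauge L1 /\ control_gauge L2 /\
  forall lambda t1 t2 (phi1 phi2 : history X d) x1 y1 x2 y2,
    0 < lambda -> A t1 phi1 x1 y1 -> A t2 phi2 x2 y2 ->
    norm (minus x1 x2)
    <= norm (minus (minus x1 x2) (scal lambda (minus y1 y2)))
       + lambda * norm (minus (h t1) (h t2)) * L1 (norm x2)
       + lambda * norm (minus (g t1) (g t2)) * norm y2
       + lambda * norm (minus (k t1) (k t2)) * L2 (sup_norm phi2)
       + K0 * lambda * sup_norm (fun s => minus (phi1 s) (phi2 s)).

(** The Yosida approximation [(d/dt)_lambda u (t)]. The improper Riemann integral
    converges for [lambda > 0] and [u] in [BUC]. *)
Definition yosida_derivative (lambda : R) (u : R -> X) (t : R) : X :=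
  scal (/ lambda)
    (minus (u t)
       (scal (/ lambda)
          (RInt_gen (fun tau => scal (exp (- tau / lambda)) (u (t - tau)))
             (at_point 0) (Rbar_locally p_infty)))).

(** [y in A x + omega x] is written [A x (y - omega x)]. *)
Definition solves_approx (omega lambda : R) (psi u : BUC X) : Prop :=
  forall t, A t (segment d psi t) (u t)
              (minus (yosida_derivative lambda u t) (scal omega (u t))).

Definition unique_approx (omega lambda : R) (psi u : BUC X) : Prop :=
  solves_approx omega lambda psi u /\
  forall v : BUC X, solves_approx omega lambda psi v -> forall t, v t = u t.

(** [w n] is [u_{n,lambda}] for [n >= 1], with the convention
    [u_{0,lambda} = psi]. *)
Definition approx_sequence (omega lambda : R) (psi : BUC X) (w : nat -> BUC X) : Prop :=
  w 0%nat = psi /\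
  forall n, unique_approx omega lambda (w n) (w (S n)).

(** [u] is the solution of [u'(t) in A(t,u_t) u(t) + omega u(t)]: for every
    starting point, [u] is the iterated uniform limit of the [u_{n,lambda}], first
    as [lambda -> 0+], then as [n -> oo]. *)
Definition is_solution (omega : R) (u : R -> X) : Prop :=
  forall psi : BUC X,
    exists (w : R -> nat -> BUC X) (v : nat -> R -> X),
      (forall lambda, 0 < lambda -> approx_sequence omega lambda psi (w lambda)) /\
      (forall n, unif_limit (at_right 0) (fun lambda => BUC_fun (w lambda n)) (v n)) /\
      unif_limit eventually v u.

End Equation.

(* Main.v *)
Require Import Defs.
From Stdlib Require Import Reals Lra Lia List.
From Stdlib Require Import ClassicalEpsilon.
From Coquelicot Require Import Coquelicot.

(** Put [alpha = - omega > 0]. For [lambda > 0] let [K_lambda = (1 + lambda d/dt)^-1], the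
    average of the past with exponential weight, so that [(d/dt)_lambda = (1 - K_lambda)
    / lambda]. The approximate equation is the fixed point equation
    [u t = (1 - kappa A(t, psi_t))^-1 (kappa / lambda K_lambda u t)],
    [kappa = 1 / (1/lambda + alpha)], a contraction since [kappa < lambda]; it defines
    [S_lambda psi = u]. Comparing two solutions at the same time shows that
    [S_lambda] has Lipschitz constant [K0 / alpha < 1], uniformly in [lambda].

    To let [lambda -> 0], the function [norm (u_lambda s - u_mu t)] is compared on the
    plane with an explicit quadratic supersolution, whose value on the diagonal is
    [O(eps + C_eps (lambda + mu))]. For the Lipschitz condition this requires a bound on
    the Yosida derivative that is uniform in [lambda]; it follows from [L_g < alpha] when
    [psi] is Lipschitz, and Lipschitz functions suffice because they are dense and the
    [S_lambda] are equicontinuous. The limit [S_0] is a contraction; its fixed point is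
    the limit of the [S_0^n psi], and [S_0] does not increase
    [sup_t norm (psi (t + T) - psi t)] by more than the factor [K0 / alpha], so that the
    fixed point is [T]-periodic. *)

Set Implicit Arguments.
Unset Strict Implicit.
Unset Printing Implicit Defensive.

Open Scope R_scope.

(** * Linear identities and norms *)

Section ModuleReflection.
Context {X : CompleteNormedModule R_AbsRing}.

(** Syntax for reflection: [ring] and [field] do not act on vectors, so a vector identity is
    compared coefficient by coefficient. Scalars are kept as plain real numbers, so each coefficient
    goal can be closed by [field] or [lra] with the hypotheses at hand. *)
Inductive mexpr : Type :=
| MVar : nat -> mexpr
| MZero : mexpr
| MPlus : mexpr -> mexpr -> mexpr
| MOpp : mexpr -> mexpr
| MScal : R -> mexpr -> mexpr.

Fixpoint meval (env : list X) (e : mexpr) : X :=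
  match e with
  | MVar n => nth n env zero
  | MZero => zero
  | MPlus a b => plus (meval env a) (meval env b)
  | MOpp a => opp (meval env a)
  | MScal k a => scal k (meval env a)
  end.

Fixpoint mcoef (e : mexpr) (n : nat) : R :=
  match e with
  | MVar m => if Nat.eqb m n then 1 else 0
  | MZero => 0
  | MPlus a b => mcoef a n + mcoef b n
  | MOpp a => - mcoef a n
  | MScal k a => k * mcoef a n
  end.

Fixpoint lincomb (env : list X) (c : nat -> R) : X :=
  match env with
  | nil => zero
  | x :: l => plus (scal (c 0%nat) x) (lincomb l (fun n => c (S n)))
  end.

Lemma lincomb_ext (env : list X) : forall c c' : nat -> R,
  (forall n, (n < length env)%nat -> c n = c' n) -> lincomb env c = lincomb env c'.
Proof.
induction env as [|x l IH]; intros c c' H; simpl; [reflexivity|].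
rewrite (H 0%nat) by (simpl; lia).
f_equal. apply IH. intros n Hn. apply H. simpl. lia.
Qed.

Lemma lincomb_zero (env : list X) : lincomb env (fun _ => 0) = zero.
Proof.
induction env as [|x l IH]; simpl; [reflexivity|].
rewrite IH, plus_zero_r. apply (scal_zero_l x).
Qed.

Lemma lincomb_plus (env : list X) : forall c c' : nat -> R,
  lincomb env (fun n => c n + c' n) = plus (lincomb env c) (lincomb env c').
Proof.
induction env as [|x l IH]; intros c c'; simpl.
- now rewrite plus_zero_l.
- rewrite IH.
  etransitivity.
  { apply f_equal2; [exact (scal_distr_r (c 0%nat : R_AbsRing) (c' 0%nat) x)|reflexivity]. }
  rewrite <- !plus_assoc. f_equal.
  rewrite !plus_assoc. f_equal. apply plus_comm.
Qed.

Lemma lincomb_scal (env : list X) (k : R) : forall c : nat -> R,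
  lincomb env (fun n => k * c n) = scal k (lincomb env c).
Proof.
induction env as [|x l IH]; intros c; simpl.
- symmetry. exact (scal_zero_r (V := X) k).
- rewrite IH. rewrite (scal_distr_l (V := X) k). f_equal.
  symmetry. exact (scal_assoc (V := X) k (c 0%nat) x).
Qed.

Lemma lincomb_opp (env : list X) (c : nat -> R) :
  lincomb env (fun n => - c n) = opp (lincomb env c).
Proof.
transitivity (scal (-1) (lincomb env c)); [|exact (scal_opp_one (V := X) _)].
rewrite <- lincomb_scal. apply lincomb_ext. intros n _. ring.
Qed.

Lemma lincomb_var (env : list X) : forall n,
  lincomb env (fun m => if Nat.eqb n m then 1 else 0) = nth n env zero.
Proof.
induction env as [|x l IH]; intros [|n]; simpl; try reflexivity.
- rewrite lincomb_zero, plus_zero_r. apply (scal_one x).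
- rewrite IH. etransitivity; [|apply plus_zero_l].
  apply (f_equal (fun y => plus y _)), (scal_zero_l (V := X) x).
Qed.

Lemma meval_lincomb (env : list X) (e : mexpr) :
  meval env e = lincomb env (mcoef e).
Proof.
induction e as [n| |a IHa b IHb|a IHa|k a IHa]; simpl.
- symmetry. apply lincomb_var.
- symmetry. apply lincomb_zero.
- now rewrite IHa, IHb, <- lincomb_plus.
- now rewrite IHa, <- lincomb_opp.
- now rewrite IHa, <- lincomb_scal.
Qed.

Lemma meval_eq (env : list X) (e e' : mexpr) :
  (forall n, (n < length env)%nat -> mcoef e n = mcoef e' n) ->
  meval env e = meval env e'.
Proof. intros H. rewrite !meval_lincomb. now apply lincomb_ext. Qed.

End ModuleReflection.

Ltac mindex env x :=
  lazymatch env with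
  | x :: _ => constr:(0%nat)
  | _ :: ?l => let n := mindex l x in constr:(S n)
  end.

Ltac mreify env t :=
  lazymatch t with
  | plus ?a ?b =>
      let a' := mreify env a in let b' := mreify env b in constr:(MPlus a' b')
  | minus ?a ?b =>
      let a' := mreify env a in let b' := mreify env b in
      constr:(MPlus a' (MOpp b'))
  | opp ?a => let a' := mreify env a in constr:(MOpp a')
  | scal ?k ?a => let a' := mreify env a in constr:(MScal k a')
  | zero => constr:(MZero)
  | _ => let n := mindex env t in constr:(MVar n)
  end.

Ltac msplit env n Hn :=
  lazymatch env with
  | nil => exfalso; lia
  | _ :: ?l => destruct n as [|n]; [cbn; clear Hn|msplit l n Hn]
  end.

(** Reduces an equation between linear combinations of the vectors listed in
    [env] to one equation between real coefficients per vector. *)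
Ltac module_eq env :=
  lazymatch goal with
  | |- ?a = ?b =>
      let ea := mreify env a in let eb := mreify env b in
      change (meval env ea = meval env eb);
      apply meval_eq;
      let n := fresh "n" in let Hn := fresh "Hn" in
      intros n Hn; cbn in Hn; msplit env n Hn
  end.

(** * Norm inequalities *)

Section NormFacts.
Context {X : CompleteNormedModule R_AbsRing}.

Lemma norm_le_eq (x y : X) (B : R) : x = y -> norm y <= B -> norm x <= B.
Proof. now intros ->. Qed.

Lemma norm_minus_sym (x y : X) : norm (minus x y) = norm (minus y x).
Proof.
rewrite <- (norm_opp (K := R_AbsRing) (V := X) (minus x y)). f_equal.
module_eq (x :: y :: nil); ring.
Qed.

Lemma norm_minus_self (x : X) : norm (minus x x) = 0.
Proof. rewrite minus_eq_zero. apply (norm_zero (K := R_AbsRing) (V := X)). Qed.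

Lemma norm_minus_triangle (x y z : X) :
  norm (minus x z) <= norm (minus x y) + norm (minus y z).
Proof.
replace (minus x z) with (plus (minus x y) (minus y z))
  by (module_eq (x :: y :: z :: nil); ring).
apply (norm_triangle (K := R_AbsRing) (V := X)).
Qed.

Lemma norm_minus_le (x y : X) : norm (minus x y) <= norm x + norm y.
Proof.
unfold minus. rewrite <- (norm_opp (K := R_AbsRing) (V := X) y).
apply (norm_triangle (K := R_AbsRing) (V := X)).
Qed.

Lemma norm_le_minus (x y : X) : norm x <= norm (minus x y) + norm y.
Proof.
replace x with (plus (minus x y) y) at 1 by (module_eq (x :: y :: nil); ring).
apply (norm_triangle (K := R_AbsRing) (V := X)).
Qed.

Lemma norm_scal_le (k : R) (x : X) (B : R) :
  0 <= k -> norm x <= B -> norm (scal k x) <= k * B.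
Proof.
intros Hk Hx. eapply Rle_trans; [apply (norm_scal (K := R_AbsRing) (V := X))|].
change (Rabs k * norm x <= k * B).
rewrite Rabs_pos_eq by assumption. now apply Rmult_le_compat_l.
Qed.

Lemma eq_of_norm_minus_le0 (x y : X) : norm (minus x y) <= 0 -> x = y.
Proof.
intros H.
assert (Hz : minus x y = zero).
{ apply (norm_eq_zero (K := R_AbsRing) (V := X)).
  apply Rle_antisym; [assumption|apply (norm_ge_0 (K := R_AbsRing) (V := X))]. }
replace x with (plus (minus x y) y) by (module_eq (x :: y :: nil); ring).
rewrite Hz. apply plus_zero_l.
Qed.

Lemma filterlim_norm_minus {T : Type} (F : (T -> Prop) -> Prop) {FF : Filter F}
    (f : T -> X) (y : X) :
  (forall eps : posreal, F (fun x => norm (minus (f x) y) < eps)) <->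
  filterlim f F (locally y).
Proof. symmetry. apply (filterlim_locally_ball_norm (K := R_AbsRing) (U := X)). Qed.

Lemma continuous_norm_minus (f : R -> X) (t : R) :
  (forall eps : posreal, exists delta : posreal,
     forall s, Rabs (s - t) < delta -> norm (minus (f s) (f t)) < eps) ->
  continuous f t.
Proof.
intros H. apply (proj1 (filterlim_norm_minus (F := locally t) f (f t))). intros eps.
destruct (H eps) as [delta Hd]. exists delta. intros s Hs. apply Hd. exact Hs.
Qed.

End NormFacts.

Lemma Rle_of_eps (a b : R) : (forall eps : posreal, a <= b + eps) -> a <= b.
Proof.
intros H. apply le_epsilon. intros e He. exact (H (mkposreal e He)).
Qed.

(** Used with [f] the norm of a difference of solutions: an a priori bound is
    improved by the equation itself. *)
Lemma self_improving_bound {I : Type} (f : I -> R) (B q c : R) :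
  0 <= q < 1 -> (forall i, f i <= B) ->
  (forall D, (forall i, f i <= D) -> forall i, f i <= q * D + c) ->
  forall i, f i <= c / (1 - q).
Proof.
intros Hq HB Himp i.
(* The bound [B] makes the supremum [M] finite, so that [q * M] can be absorbed in
   [M <= q * M + c]. *)
destruct (completeness (fun y => exists j, y = f j)) as [M [Mub Mlub]].
- exists B. intros y [j ->]. apply HB.
- exists (f i). now exists i.
- assert (HM : forall j, f j <= M) by (intros j; apply Mub; now exists j).
  assert (HM' : M <= q * M + c).
  { apply Mlub. intros y [j ->]. now apply Himp. }
  apply Rle_trans with M; [apply HM|].
  apply Rmult_le_reg_r with (1 - q); [lra|].
  replace (c / (1 - q) * (1 - q)) with c by (field; lra). lra.
Qed.

(** * Averages with exponential weight *)

Lemma is_RInt_gen_half_line {V : CompleteNormedModule R_AbsRing} (f G : R -> V) (l : V) :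
  (forall b, 0 <= b -> is_RInt f 0 b (G b)) ->
  filterlim G (Rbar_locally p_infty) (locally l) ->
  is_RInt_gen f (at_point 0) (Rbar_locally p_infty) l.
Proof.
intros Hf HG P HP.
apply Filter_prod with (fun a => a = 0) (fun b => 0 <= b /\ P (G b)).
- reflexivity.
- apply filter_and; [|exact (HG P HP)]. exists 0. intros x Hx. lra.
- intros a b -> [Hb HPb]. exists (G b). split; [now apply Hf|assumption].
Qed.

(** The antiderivative of [exp (- tau / lambda) * (p + q * tau + r * tau ^ 2)] that vanishes at
    infinity. Degree two is what the quadratic barrier of [comparison_doubled] requires. *)
Definition exp_moment_primitive (lambda p q r tau : R) : R :=
  - lambda * exp (- tau / lambda) *
  (p + q * (tau + lambda) + r * (tau ^ 2 + 2 * lambda * tau + 2 * lambda ^ 2)).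

Lemma is_RInt_exp_moment (lambda p q r a b : R) :
  0 < lambda ->
  is_RInt (fun tau => exp (- tau / lambda) * (p + q * tau + r * tau ^ 2)) a b
    (exp_moment_primitive lambda p q r b - exp_moment_primitive lambda p q r a).
Proof.
intros Hl.
apply (is_RInt_derive (exp_moment_primitive lambda p q r)).
- intros x _. unfold exp_moment_primitive. auto_derive; [lra|].
  unfold Rdiv. field. lra.
- intros x _. apply (ex_derive_continuous (K := R_AbsRing) (V := R_NormedModule)).
  auto_derive. lra.
Qed.

(** The cube of [1 + x / 3 <= exp (x / 3)]. Cubic decay leaves one power to spare against a
    quadratic factor. *)
Lemma exp_neg_cube (x : R) : 0 <= x -> exp (- x) * (1 + x / 3) ^ 3 <= 1.
Proof.
intros Hx.
replace (exp (- x)) with (exp (- (x / 3)) ^ 3)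
  by (simpl; rewrite Rmult_1_r, <- !exp_plus; f_equal; lra).
rewrite <- Rpow_mult_distr, <- (pow1 3). apply pow_incr. split.
- apply Rmult_le_pos; [left; apply exp_pos|lra].
- rewrite pow1, exp_Ropp. apply Rmult_le_reg_l with (exp (x / 3)); [apply exp_pos|].
  rewrite <- Rmult_assoc, Rinv_r by (generalize (exp_pos (x / 3)); lra).
  destruct (Req_dec x 0) as [->|Hx0].
  + replace (0 / 3) with 0 by lra. rewrite exp_0. lra.
  + generalize (exp_ineq1 (x / 3)). lra.
Qed.

(** With [y = 1 + b / lambda / 3], the polynomial factor is at most a constant times [y ^ 2], since
    [b <= 3 * lambda * y], and the exponential is at most [1 / y ^ 3]. The primitive is therefore at
    most [C / y]. *)
Lemma exp_moment_primitive_lim (lambda p q r : R) :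
  0 < lambda ->
  filterlim (exp_moment_primitive lambda p q r) (Rbar_locally p_infty) (locally 0).
Proof.
intros Hl.
set (c0 := p + q * lambda + 2 * r * lambda ^ 2).
set (c1 := q + 2 * r * lambda).
set (C := lambda * (Rabs c0 + Rabs c1 * (3 * lambda) + Rabs r * (3 * lambda) ^ 2)).
assert (HC : 0 <= C).
{ unfold C. apply Rmult_le_pos; [lra|].
  generalize (Rabs_pos c0) (Rabs_pos c1) (Rabs_pos r) (pow2_ge_0 (3 * lambda)). nra. }
assert (Hb : forall b, 0 <= b ->
  Rabs (exp_moment_primitive lambda p q r b) * (1 + b / lambda / 3) <= C).
{ intros b Hb.
  set (y := 1 + b / lambda / 3).
  assert (Hbl : 0 <= b / lambda) by (apply Rdiv_le_0_compat; lra).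
  assert (Hy : 1 <= y) by (unfold y; lra).
  assert (Hby : b <= 3 * lambda * y).
  { unfold y.
    replace (3 * lambda * (1 + b / lambda / 3)) with (3 * lambda + b) by (field; lra). lra. }
  assert (He : exp (- b / lambda) * y ^ 3 <= 1).
  { replace (- b / lambda) with (- (b / lambda)) by (field; lra). now apply exp_neg_cube. }
  unfold exp_moment_primitive.
  replace (p + q * (b + lambda) + r * (b ^ 2 + 2 * lambda * b + 2 * lambda ^ 2))
    with (c0 + c1 * b + r * b ^ 2) by (unfold c0, c1; ring).
  rewrite !Rabs_mult, Rabs_Ropp, (Rabs_pos_eq lambda), (Rabs_pos_eq (exp _))
    by (try (left; apply exp_pos); lra).
  assert (Hp : Rabs (c0 + c1 * b + r * b ^ 2)
     <= (Rabs c0 + Rabs c1 * (3 * lambda) + Rabs r * (3 * lambda) ^ 2) * y ^ 2).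
  { assert (Hb2 : b ^ 2 <= (3 * lambda) ^ 2 * y ^ 2).
    { rewrite <- Rpow_mult_distr. apply pow_incr. lra. }
    assert (Hy2 : y <= y ^ 2) by nra.
    apply Rle_trans with (Rabs c0 + Rabs c1 * b + Rabs r * b ^ 2).
    - eapply Rle_trans; [apply Rabs_triang|]. apply Rplus_le_compat.
      + eapply Rle_trans; [apply Rabs_triang|]. rewrite Rabs_mult, (Rabs_pos_eq b) by lra. lra.
      + rewrite Rabs_mult, (Rabs_pos_eq (b ^ 2)) by apply pow2_ge_0. lra.
    - generalize (Rabs_pos c0) (Rabs_pos c1) (Rabs_pos r). intros H0 H1 H2.
      rewrite !Rmult_plus_distr_r. apply Rplus_le_compat; [apply Rplus_le_compat|].
      + nra.
      + rewrite Rmult_assoc. apply Rmult_le_compat_l; [assumption|]. nra.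
      + rewrite Rmult_assoc. now apply Rmult_le_compat_l. }
  set (K := Rabs c0 + Rabs c1 * (3 * lambda) + Rabs r * (3 * lambda) ^ 2) in *.
  replace C with (lambda * K) by reflexivity.
  rewrite !Rmult_assoc. apply Rmult_le_compat_l; [lra|].
  assert (HK : 0 <= K).
  { apply Rmult_le_reg_l with lambda; [lra|]. rewrite Rmult_0_r. exact HC. }
  apply Rle_trans with (exp (- b / lambda) * (K * y ^ 2 * y)).
  - apply Rmult_le_compat_l; [left; apply exp_pos|].
    apply Rmult_le_compat_r; lra.
  - replace (exp (- b / lambda) * (K * y ^ 2 * y)) with (K * (exp (- b / lambda) * y ^ 3)) by ring.
    nra. }
apply (proj1 (filterlim_norm_minus (X := R_CompleteNormedModule) _ _)). intros eps.
(* Beyond this threshold [C / eps < b / lambda / 3], hence [C / y < eps]. *)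
exists (3 * lambda * C / eps).
intros b Hbig.
assert (He := cond_pos eps).
assert (H0 : 0 <= 3 * lambda * C / eps) by (apply Rdiv_le_0_compat; nra).
change (Rabs (exp_moment_primitive lambda p q r b - 0) < eps).
rewrite Rminus_0_r.
specialize (Hb b ltac:(lra)).
assert (Hbl : C / eps < b / lambda / 3).
{ apply Rmult_lt_reg_r with (3 * lambda); [lra|].
  replace (b / lambda / 3 * (3 * lambda)) with b by (field; lra).
  replace (C / eps * (3 * lambda)) with (3 * lambda * C / eps) by (field; lra). assumption. }
assert (H1 : 0 <= C / eps) by (apply Rdiv_le_0_compat; lra).
apply Rnot_le_lt. intros Hc.
assert (H2 : eps * (1 + b / lambda / 3) <= C).
{ eapply Rle_trans; [|exact Hb]. apply Rmult_le_compat_r; lra. }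
assert (H3 : eps * (C / eps) = C) by (field; lra).
nra.
Qed.

Lemma is_RInt_gen_exp_moment (lambda p q r : R) :
  0 < lambda ->
  is_RInt_gen (fun tau => exp (- tau / lambda) * (p + q * tau + r * tau ^ 2))
    (at_point 0) (Rbar_locally p_infty)
    (lambda * (p + q * lambda + 2 * r * lambda ^ 2)).
Proof.
intros Hl.
apply (@is_RInt_gen_half_line R_CompleteNormedModule _
  (fun b => exp_moment_primitive lambda p q r b - exp_moment_primitive lambda p q r 0)).
- intros b _. now apply is_RInt_exp_moment.
- replace (lambda * (p + q * lambda + 2 * r * lambda ^ 2))
    with (0 - exp_moment_primitive lambda p q r 0).
  + apply (filterlim_comp_2 (G := locally 0)
      (H := locally (- exp_moment_primitive lambda p q r 0))
      (exp_moment_primitive lambda p q r)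
      (fun _ => - exp_moment_primitive lambda p q r 0) Rplus).
    * now apply exp_moment_primitive_lim.
    * apply filterlim_const.
    * apply (filterlim_plus (V := R_NormedModule)).
  + unfold exp_moment_primitive. replace (- 0 / lambda) with 0 by (field; lra).
    rewrite exp_0. ring.
Qed.

Section ExpAverage.
Context {X : CompleteNormedModule R_AbsRing}.

(** The resolvent [(1 + lambda d/dt)^-1], read at one time from the past values
    [f tau = u (t - tau)]. *)
Definition exp_average (lambda : R) (f : R -> X) : X :=
  scal (/ lambda)
    (RInt_gen (fun tau => scal (exp (- tau / lambda)) (f tau))
       (at_point 0) (Rbar_locally p_infty)).

Lemma ex_RInt_exp_weight (lambda : R) (f : R -> X) (a b : R) :
  0 < lambda -> (forall tau, continuous f tau) ->
  ex_RInt (fun tau => scal (exp (- tau / lambda)) (f tau)) a b.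
Proof.
intros Hl Hc. apply (ex_RInt_continuous (V := X)). intros z _.
apply (continuous_scal (K := R_AbsRing) (V := X) (fun tau => exp (- tau / lambda)) f).
- apply (ex_derive_continuous (K := R_AbsRing) (V := R_NormedModule)).
  auto_derive. lra.
- apply Hc.
Qed.

Lemma norm_RInt_exp_weight (lambda M : R) (f : R -> X) (a b : R) :
  0 < lambda -> (forall tau, continuous f tau) -> (forall tau, norm (f tau) <= M) ->
  a <= b ->
  norm (RInt (fun tau => scal (exp (- tau / lambda)) (f tau)) a b)
  <= exp_moment_primitive lambda M 0 0 b - exp_moment_primitive lambda M 0 0 a.
Proof.
intros Hl Hc HM Hab.
apply (norm_RInt_le (V := X) (fun tau => scal (exp (- tau / lambda)) (f tau))
  (fun tau => exp (- tau / lambda) * (M + 0 * tau + 0 * tau ^ 2)) a b); [assumption| | |].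
- intros x _. apply norm_scal_le; [left; apply exp_pos|].
  generalize (HM x). lra.
- apply (RInt_correct (V := X)). now apply ex_RInt_exp_weight.
- now apply is_RInt_exp_moment.
Qed.

(** The integral over [[u, v]] is dominated by that of [M * exp (- tau / lambda)], whose primitive
    tends to 0. The partial integrals are thus Cauchy, and completeness of [X] gives the limit. *)
Lemma ex_RInt_gen_exp_weight (lambda M : R) (f : R -> X) :
  0 < lambda -> (forall tau, continuous f tau) -> (forall tau, norm (f tau) <= M) ->
  ex_RInt_gen (fun tau => scal (exp (- tau / lambda)) (f tau))
    (at_point 0) (Rbar_locally p_infty).
Proof.
intros Hl Hc HM.
set (F := fun tau => scal (exp (- tau / lambda)) (f tau)).
assert (Hex : forall a b, ex_RInt F a b) by (intros; now apply ex_RInt_exp_weight).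
destruct (proj1 (filterlim_locally_cauchy (U := X) (F := Rbar_locally p_infty)
            (fun b => RInt F 0 b))) as [l Hlim].
- intros eps.
  destruct (proj2 (filterlim_norm_minus (X := R_CompleteNormedModule) _ _)
    (exp_moment_primitive_lim M 0 0 Hl) (pos_div_2 eps)) as [B HB].
  assert (HBb : forall b, B < b -> Rabs (exp_moment_primitive lambda M 0 0 b) < eps / 2).
  { intros b Hb. generalize (HB b Hb).
    change (norm (minus (exp_moment_primitive lambda M 0 0 b) 0))
      with (Rabs (exp_moment_primitive lambda M 0 0 b - 0)).
    now rewrite Rminus_0_r. }
  assert (Hle : forall u v, B < u -> u <= v -> norm (minus (RInt F 0 v) (RInt F 0 u)) < eps).
  { intros u v Hu Huv.
    replace (minus (RInt F 0 v) (RInt F 0 u)) with (RInt F u v).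
    - eapply Rle_lt_trans; [apply (@norm_RInt_exp_weight lambda M f u v); assumption|].
      generalize (HBb u Hu) (HBb v ltac:(lra)).
      intros H1 H2. apply Rabs_def2 in H1. apply Rabs_def2 in H2. lra.
    - rewrite <- (RInt_Chasles (V := X) F 0 u v) by apply Hex.
      module_eq (RInt F 0 u :: RInt F u v :: nil); ring. }
  exists (fun b => B < b). split; [now exists B|].
  intros u v Hu Hv. apply (norm_compat1 (K := R_AbsRing) (V := X)).
  destruct (Rle_dec u v) as [Huv|Huv].
  + now apply Hle.
  + eapply Rle_lt_trans; [right; apply (norm_minus_sym (X := X))|]. apply Hle; lra.
- exists l. apply is_RInt_gen_half_line with (fun b => RInt F 0 b); [|assumption].
  intros b _. apply (RInt_correct (V := X)). apply Hex.
Qed.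

(** The weight is the density of the exponential law with mean [lambda], whose moments of order 0,
    1, 2 are 1, [lambda], [2 * lambda ^ 2]; the pointwise bound is integrated against it. *)
Lemma exp_average_dist (lambda p q r M N : R) (f g : R -> X) :
  0 < lambda ->
  (forall tau, continuous f tau) -> (forall tau, norm (f tau) <= M) ->
  (forall tau, continuous g tau) -> (forall tau, norm (g tau) <= N) ->
  (forall tau, 0 <= tau -> norm (minus (f tau) (g tau)) <= p + q * tau + r * tau ^ 2) ->
  norm (minus (exp_average lambda f) (exp_average lambda g))
  <= p + q * lambda + 2 * r * lambda ^ 2.
Proof.
intros Hl Hfc Hfb Hgc Hgb Hfg. unfold exp_average.
set (If := RInt_gen _ _ _). set (Ig := RInt_gen _ _ _).
assert (HI : norm (minus If Ig) <= lambda * (p + q * lambda + 2 * r * lambda ^ 2)).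
{ apply (RInt_gen_norm (V := X) (Fa := at_point 0) (Fb := Rbar_locally p_infty)
    (fun tau => minus (scal (exp (- tau / lambda)) (f tau)) (scal (exp (- tau / lambda)) (g tau)))
    (fun tau => exp (- tau / lambda) * (p + q * tau + r * tau ^ 2))).
  - apply Filter_prod with (fun a => a = 0) (fun b => 0 <= b); simpl.
    + reflexivity.
    + exists 0. intros x Hx. lra.
    + intros a b -> Hb. exact Hb.
  - apply Filter_prod with (fun a => a = 0) (fun b => 0 <= b); simpl.
    + reflexivity.
    + exists 0. intros x Hx. lra.
    + intros a b -> _ x Hx.
      apply norm_le_eq with (scal (exp (- x / lambda)) (minus (f x) (g x)));
        [module_eq (f x :: g x :: nil); ring|].
      apply norm_scal_le; [left; apply exp_pos|]. apply Hfg. lra.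
  - apply (is_RInt_gen_minus (V := X)); apply (RInt_gen_correct (V := X));
      eapply ex_RInt_gen_exp_weight; eassumption.
  - now apply is_RInt_gen_exp_moment. }
apply norm_le_eq with (scal (/ lambda) (minus If Ig));
  [module_eq (If :: Ig :: nil); ring|].
eapply Rle_trans.
- apply norm_scal_le; [|exact HI]. left. now apply Rinv_0_lt_compat.
- right. field. lra.
Qed.

Lemma exp_average_const (lambda : R) (c : X) :
  0 < lambda -> exp_average lambda (fun _ => c) = c.
Proof.
intros Hl. unfold exp_average.
rewrite (is_RInt_gen_unique (V := X) _ (scal lambda c)).
- rewrite <- (scal_one (K := R_AbsRing) c) at 2.
  change (scal (/ lambda) (scal lambda c) = scal 1 c).
  module_eq (c :: nil). field. lra.
- set (P := exp_moment_primitive lambda 1 0 0).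
  apply is_RInt_gen_half_line
    with (fun b => minus (scal (P b) c) (scal (P 0) c)).
  + intros b _. apply (is_RInt_derive (V := X) (fun tau => scal (P tau) c)).
    * intros x _. apply (is_derive_scal_l (K := R_AbsRing) (V := X) P).
      unfold P, exp_moment_primitive. auto_derive; [lra|]. unfold Rdiv. field. lra.
    * intros x _. apply (continuous_scal (K := R_AbsRing) (V := X)
        (fun tau => exp (- tau / lambda)) (fun _ => c)).
      -- apply (ex_derive_continuous (K := R_AbsRing) (V := R_NormedModule)).
         auto_derive. lra.
      -- apply continuous_const.
  + replace (scal lambda c) with (minus (scal 0 c) (scal (P 0) c)).
    * apply (filterlim_comp_2 (G := locally (scal 0 c : X))
        (H := locally (opp (scal (P 0) c) : X)) (fun b => scal (P b) c)
        (fun _ => opp (scal (P 0) c)) plus).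
      -- apply (filterlim_comp _ _ _ P (fun k => scal k c) _ (locally 0)).
         ++ now apply exp_moment_primitive_lim.
         ++ apply (filterlim_scal_l (K := R_AbsRing) (V := X)).
      -- apply filterlim_const.
      -- apply (filterlim_plus (V := X)).
    * unfold P, exp_moment_primitive. replace (- 0 / lambda) with 0 by (field; lra).
      rewrite exp_0. module_eq (c :: nil). ring.
Qed.

End ExpAverage.

(** * Comparison principles *)

Section BUCFacts.
Context {X : CompleteNormedModule R_AbsRing}.

Lemma BUC_const_proof (c : X) :
  bounded_fun (fun _ : R => c) /\ unif_continuous_fun (fun t : R => t) (fun _ : R => c).
Proof.
split.
- exists (norm c). intros _. lra.
- intros eps. exists eps. intros s s' _. rewrite norm_minus_self. apply cond_pos.
Qed.

Definition BUC_const (c : X) : BUC X :=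
  mkBUC (proj1 (BUC_const_proof c)) (proj2 (BUC_const_proof c)).

Lemma BUC_past_continuous (u : BUC X) (t tau : R) :
  continuous (fun tau => u (t - tau)) tau.
Proof.
apply continuous_norm_minus. intros eps.
destruct (BUC_unif_continuous u eps) as [delta Hd].
exists delta. intros s Hs. apply Hd. rewrite Rabs_minus_sym.
replace (t - tau - (t - s)) with (s - tau) by ring. exact Hs.
Qed.

Definition past_average (lambda : R) (u : R -> X) (t : R) : X :=
  exp_average lambda (fun tau => u (t - tau)).

Lemma past_average_dist (lambda p q r s t : R) (u v : BUC X) :
  0 < lambda ->
  (forall tau, 0 <= tau ->
     norm (minus (u (s - tau)) (v (t - tau))) <= p + q * tau + r * tau ^ 2) ->
  norm (minus (past_average lambda u s) (past_average lambda v t))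
  <= p + q * lambda + 2 * r * lambda ^ 2.
Proof.
intros Hl H.
destruct (BUC_bounded u) as [M HM]. destruct (BUC_bounded v) as [N HN].
eapply exp_average_dist; try eassumption.
- intros tau. apply BUC_past_continuous.
- intros tau. apply HM.
- intros tau. apply BUC_past_continuous.
- intros tau. apply HN.
Qed.

Lemma past_average_dist_const (lambda p q r t : R) (u : BUC X) (c : X) :
  0 < lambda ->
  (forall tau, 0 <= tau -> norm (minus (u (t - tau)) c) <= p + q * tau + r * tau ^ 2) ->
  norm (minus (past_average lambda u t) c) <= p + q * lambda + 2 * r * lambda ^ 2.
Proof.
intros Hl H.
rewrite <- (exp_average_const c Hl).
exact (@past_average_dist lambda p q r t t u (BUC_const c) Hl H).
Qed.

Lemma past_average_lipschitz (lambda : R) (u v : BUC X) (s t D : R) :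
  0 < lambda ->
  (forall tau, norm (minus (u (s - tau)) (v (t - tau))) <= D) ->
  norm (minus (past_average lambda u s) (past_average lambda v t)) <= D.
Proof.
intros Hl H.
replace D with (D + 0 * lambda + 2 * 0 * lambda ^ 2) by ring.
apply past_average_dist; [assumption|]. intros tau _. generalize (H tau). lra.
Qed.

Lemma norm_past_average_le (lambda M t : R) (u : BUC X) :
  0 < lambda -> (forall s, norm (u s) <= M) -> norm (past_average lambda u t) <= M.
Proof.
intros Hl HM.
replace M with (M + 0 * lambda + 2 * 0 * lambda ^ 2) by ring.
apply norm_le_eq with (minus (past_average lambda u t) zero).
- module_eq (past_average lambda u t :: nil). ring.
- apply past_average_dist_const; [assumption|]. intros tau _.
  apply norm_le_eq with (u (t - tau)).
  + module_eq (u (t - tau) :: nil). ring.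
  + generalize (HM (t - tau)). lra.
Qed.

(** [drift omega lambda u t] is the second component of the pair of [A] in
    [solves_approx]. *)
Definition drift (omega lambda : R) (u : R -> X) (t : R) : X :=
  minus (yosida_derivative lambda u t) (scal omega (u t)).

Lemma drift_eq (omega lambda : R) (u : R -> X) (t : R) :
  drift omega lambda u t
  = minus (scal (/ lambda) (minus (u t) (past_average lambda u t))) (scal omega (u t)).
Proof. reflexivity. Qed.

Lemma norm_drift_le (omega lambda D M t : R) (u : R -> X) :
  omega < 0 -> 0 < lambda ->
  norm (minus (u t) (past_average lambda u t)) <= D -> norm (u t) <= M ->
  norm (drift omega lambda u t) <= / lambda * D + - omega * M.
Proof.
intros Ho Hl HD HM. rewrite drift_eq.
apply norm_le_eq with
  (plus (scal (/ lambda) (minus (u t) (past_average lambda u t))) (scal (- omega) (u t))).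
- module_eq (u t :: past_average lambda u t :: nil); ring.
- eapply Rle_trans; [apply (norm_triangle (K := R_AbsRing) (V := X))|].
  apply Rplus_le_compat; apply norm_scal_le; try assumption; [|lra].
  left. now apply Rinv_0_lt_compat.
Qed.

(** Taking [kappa = 1 / (1/lambda - omega)] cancels [u (t + c)] and [v t] on the
    right-hand side, which leaves the past averages with a factor below [1]. *)
Lemma comparison_shift (omega lambda c sigma : R) (u v : BUC X) :
  omega < 0 -> 0 < lambda ->
  (forall t kappa, 0 < kappa ->
     norm (minus (u (t + c)) (v t))
     <= norm (minus (minus (u (t + c)) (v t))
          (scal kappa (minus (drift omega lambda u (t + c)) (drift omega lambda v t))))
        + kappa * sigma) ->
  forall t, norm (minus (u (t + c)) (v t)) <= sigma / - omega.
Proof.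
intros Ho Hl H.
set (kappa := lambda / (1 - lambda * omega)).
assert (Hlo : 0 < 1 - lambda * omega) by nra.
assert (Hk : 0 < kappa) by (apply Rdiv_lt_0_compat; lra).
assert (Hq : kappa / lambda = / (1 - lambda * omega)) by (unfold kappa; field; lra).
assert (Hq1 : 0 <= kappa / lambda < 1).
{ rewrite Hq. split.
  - left. now apply Rinv_0_lt_compat.
  - rewrite <- Rinv_1. apply Rinv_lt_contravar; nra. }
(* Here [1 - kappa / lambda = - omega * kappa], so [kappa] cancels and the bound does not depend on
   [lambda]. *)
replace (sigma / - omega) with (kappa * sigma / (1 - kappa / lambda))
  by (unfold kappa; field; repeat split; nra).
destruct (BUC_bounded u) as [M HM]. destruct (BUC_bounded v) as [N HN].
apply self_improving_bound with (f := fun t => norm (minus (u (t + c)) (v t))) (B := M + N);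
  [assumption| |].
- intros t. eapply Rle_trans; [apply norm_minus_le|]. now apply Rplus_le_compat.
- intros D HD t. eapply Rle_trans; [exact (H t kappa Hk)|].
  apply Rplus_le_compat_r.
  apply norm_le_eq with (scal (kappa / lambda)
    (minus (past_average lambda u (t + c)) (past_average lambda v t))).
  + rewrite !drift_eq.
    module_eq (u (t + c) :: v t :: past_average lambda u (t + c)
      :: past_average lambda v t :: nil); unfold kappa; field; lra.
  + apply norm_scal_le; [lra|]. apply past_average_lipschitz; [assumption|].
    intros tau. replace (t + c - tau) with (t - tau + c) by ring. apply HD.
Qed.

(** Doubling of variables: [b s t = e / alpha + C ((s - t)^2 / alpha + 2 (lambda + mu)
    / alpha^2)], [alpha = - omega], solves [((d/ds)_lambda + (d/dt)_mu + alpha) b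
    = e + C (s - t)^2] exactly, and [norm (u s - v t)] is a subsolution of the same
    equation. *)
Lemma comparison_doubled (omega lambda mu e C : R) (u v : BUC X) :
  omega < 0 -> 0 < lambda -> 0 < mu -> 0 <= e -> 0 <= C ->
  (forall s t kappa, 0 < kappa ->
     norm (minus (u s) (v t))
     <= norm (minus (minus (u s) (v t))
          (scal kappa (minus (drift omega lambda u s) (drift omega mu v t))))
        + kappa * (e + C * (s - t) ^ 2)) ->
  forall s t, norm (minus (u s) (v t))
    <= e / - omega + C * ((s - t) ^ 2 / - omega + 2 * (lambda + mu) / omega ^ 2).
Proof.
intros Ho Hl Hm He HC H.
set (b := fun s t : R =>
  e / - omega + C * ((s - t) ^ 2 / - omega + 2 * (lambda + mu) / omega ^ 2)).
assert (Hb : forall s t, 0 <= b s t).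
{ intros s t. unfold b. apply Rplus_le_le_0_compat.
  - apply Rdiv_le_0_compat; lra.
  - apply Rmult_le_pos; [assumption|]. apply Rplus_le_le_0_compat.
    + apply Rdiv_le_0_compat; [apply pow2_ge_0|lra].
    + apply Rdiv_le_0_compat; [lra|]. nra. }
(* With this [kappa] the right-hand side becomes [kappa / lambda] times (average of [u] minus [v t])
   plus [kappa / mu] times ([u s] minus average of [v]): each term averages in one variable only. *)
set (kappa := / (/ lambda + / mu - omega)).
assert (Hil := Rinv_0_lt_compat _ Hl). assert (Him := Rinv_0_lt_compat _ Hm).
assert (Hk : 0 < kappa) by (apply Rinv_0_lt_compat; lra).
assert (Hk1 : kappa * (/ lambda + / mu - omega) = 1) by (apply Rinv_l; lra).
(* The excess over the barrier [b] is a function on the plane, bounded above because [b] is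
   nonnegative. It improves itself with factor [1 + kappa * omega < 1] and no remainder, hence is
   nowhere positive. *)
enough (Hmain : forall st : R * R,
  norm (minus (u (fst st)) (v (snd st))) - b (fst st) (snd st) <= 0 / (1 - (1 + kappa * omega))).
{ intros s t. specialize (Hmain (s, t)). simpl in Hmain.
  unfold Rdiv in Hmain at 1. rewrite Rmult_0_l in Hmain. fold (b s t). lra. }
destruct (BUC_bounded u) as [M HM]. destruct (BUC_bounded v) as [N HN].
apply self_improving_bound with (B := M + N)
  (f := fun st : R * R => norm (minus (u (fst st)) (v (snd st))) - b (fst st) (snd st)).
- split; nra.
- intros [s t]. simpl. generalize (Hb s t) (norm_minus_le (u s) (v t)) (HM s) (HN t). lra.
- intros D HD [s t]. simpl.
  assert (HD' : forall s t, norm (minus (u s) (v t)) <= D + b s t)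
    by (intros s' t'; generalize (HD (s', t')); simpl; lra).
  (* As a function of [tau], [b (s - tau) t] is a quadratic polynomial; averaging replaces [tau] by
     [lambda] and [tau ^ 2] by [2 * lambda ^ 2]. *)
  assert (H1 : norm (minus (past_average lambda u s) (v t))
    <= D + b s t + C / - omega * (- 2 * (s - t) * lambda + 2 * lambda ^ 2)).
  { eapply Rle_trans.
    - apply (@past_average_dist_const lambda (D + b s t) (C / - omega * (- 2 * (s - t)))
        (C / - omega)); [assumption|].
      intros tau _. eapply Rle_trans; [apply HD'|]. right. unfold b. field. lra.
    - right. ring. }
  assert (H2 : norm (minus (u s) (past_average mu v t))
    <= D + b s t + C / - omega * (2 * (s - t) * mu + 2 * mu ^ 2)).
  { rewrite norm_minus_sym. eapply Rle_trans.
    - apply (@past_average_dist_const mu (D + b s t) (C / - omega * (2 * (s - t)))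
        (C / - omega)); [assumption|].
      intros tau _. rewrite norm_minus_sym. eapply Rle_trans; [apply HD'|].
      right. unfold b. field. lra.
    - right. ring. }
  generalize (H s t kappa Hk). intros H0.
  assert (H3 : norm (minus (minus (u s) (v t))
      (scal kappa (minus (drift omega lambda u s) (drift omega mu v t))))
    <= kappa * / lambda * (D + b s t + C / - omega * (- 2 * (s - t) * lambda + 2 * lambda ^ 2))
       + kappa * / mu * (D + b s t + C / - omega * (2 * (s - t) * mu + 2 * mu ^ 2))).
  { apply norm_le_eq with
      (plus (scal (kappa * / lambda) (minus (past_average lambda u s) (v t)))
            (scal (kappa * / mu) (minus (u s) (past_average mu v t)))).
    - rewrite !drift_eq.
      module_eq (u s :: v t :: past_average lambda u s :: past_average mu v t :: nil);
        lra.
    - eapply Rle_trans; [apply (norm_triangle (K := R_AbsRing) (V := X))|].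
      apply Rplus_le_compat; (apply norm_scal_le; [nra|assumption]). }
  (* The terms linear in [s - t] cancel between the two averages; the rest is the equation solved by
     [b]. *)
  assert (H4 : kappa * / lambda
         * (D + b s t + C / - omega * (- 2 * (s - t) * lambda + 2 * lambda ^ 2))
       + kappa * / mu * (D + b s t + C / - omega * (2 * (s - t) * mu + 2 * mu ^ 2))
       + kappa * (e + C * (s - t) ^ 2) = (1 + kappa * omega) * D + b s t).
  { assert (Hlm : 0 < lambda * mu) by nra.
    unfold b, kappa. field. repeat split; nra. }
  lra.
Qed.

End BUCFacts.

(** * Complete spaces of bounded uniformly continuous functions *)

Lemma lipschitz_unif_continuous {X : CompleteNormedModule R_AbsRing}
    (f : R -> X) (L : R) :
  (forall s t, norm (minus (f s) (f t)) <= L * Rabs (s - t)) ->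
  unif_continuous_fun (fun t : R => t) f.
Proof.
intros HL eps.
(* The maximum with 1 permits the division when [L] is 0. *)
assert (HM : 0 < Rmax L 1) by (generalize (Rmax_r L 1); lra).
exists (mkposreal _ (Rdiv_lt_0_compat _ _ (cond_pos eps) HM)). simpl.
intros s s' Hs. eapply Rle_lt_trans; [apply HL|].
apply Rle_lt_trans with (Rmax L 1 * Rabs (s' - s)).
- apply Rmult_le_compat_r; [apply Rabs_pos|apply Rmax_l].
- apply Rmult_lt_compat_l with (r := Rmax L 1) in Hs; [|assumption].
  replace (Rmax L 1 * (eps / Rmax L 1)) with (pos eps) in Hs by (field; lra). assumption.
Qed.

(** Within distance [delta] uniform continuity gives [eps]; farther apart, the trivial bound [2 * M]
    is at most [2 * M * (s - t) ^ 2 / delta ^ 2]. This puts a modulus of continuity into the form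
    required by [comparison_doubled]. *)
Lemma quadratic_modulus {X : CompleteNormedModule R_AbsRing} (f : R -> X) (eps : R) :
  bounded_fun f -> unif_continuous_fun (fun t : R => t) f -> 0 < eps ->
  exists C, 0 <= C /\ forall s t, norm (minus (f s) (f t)) <= eps + C * (s - t) ^ 2.
Proof.
intros [M HM] Huc He.
destruct (Huc (mkposreal eps He)) as [delta Hd]. simpl in Hd.
assert (Hdp := cond_pos delta).
assert (HM0 : 0 <= M)
  by (eapply Rle_trans; [apply (norm_ge_0 (K := R_AbsRing) (V := X))|exact (HM 0)]).
assert (Hd2 : 0 < delta ^ 2) by nra.
exists (2 * M / delta ^ 2). split; [apply Rdiv_le_0_compat; lra|].
intros s t. destruct (Rlt_le_dec (Rabs (s - t)) delta) as [Hst|Hst].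
- specialize (Hd t s Hst).
  assert (0 <= 2 * M / delta ^ 2 * (s - t) ^ 2)
    by (apply Rmult_le_pos; [apply Rdiv_le_0_compat; lra|apply pow2_ge_0]).
  lra.
- apply Rle_trans with (2 * M).
  + eapply Rle_trans; [apply norm_minus_le|]. generalize (HM s) (HM t). lra.
  + assert (Hp : delta ^ 2 <= (s - t) ^ 2).
    { rewrite <- (pow2_abs (s - t)). apply pow_incr. lra. }
    assert (2 * M / delta ^ 2 * delta ^ 2 <= 2 * M / delta ^ 2 * (s - t) ^ 2)
      by (apply Rmult_le_compat_l; [apply Rdiv_le_0_compat; lra|assumption]).
    assert (2 * M / delta ^ 2 * delta ^ 2 = 2 * M) by (field; lra).
    lra.
Qed.

(** * Bounds for the supremum norm *)

Section SupNorm.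
Context {X : CompleteNormedModule R_AbsRing} {S : Type}.

Lemma sup_norm_le (f : S -> X) (M : R) :
  0 <= M -> (forall s, norm (f s) <= M) -> sup_norm f <= M.
Proof.
intros HM Hf. unfold sup_norm.
destruct (Lub_Rbar_correct (fun y => exists s, y = norm (f s))) as [_ Hlub].
assert (Hle : Rbar_le (Lub_Rbar (fun y => exists s, y = norm (f s))) M).
{ apply Hlub. intros y [s ->]. apply Hf. }
(* In the case [m_infty], which occurs for empty [S], the real value is 0 and [0 <= M] closes the
   goal. *)
destruct (Lub_Rbar _); simpl in *; [assumption|easy|assumption].
Qed.

Lemma sup_norm_ge0 (f : S -> X) : 0 <= sup_norm f.
Proof.
unfold sup_norm.
destruct (Lub_Rbar_correct (fun y => exists s, y = norm (f s))) as [Hub _].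
destruct (Lub_Rbar _) as [l| |] eqn:E; simpl; try lra.
destruct (classic (exists s : S, True)) as [[s _]|Hno].
- eapply Rle_trans; [apply (norm_ge_0 (K := R_AbsRing) (V := X))|].
  exact (Hub _ (ex_intro _ s eq_refl)).
(* A finite least upper bound is impossible for empty [S], where [m_infty] is already an upper
   bound. *)
- exfalso.
  destruct (Lub_Rbar_correct (fun y => exists s, y = norm (f s))) as [_ Hlub].
  rewrite E in Hlub. apply (Hlub m_infty). intros y [s _]. apply Hno. now exists s.
Qed.

End SupNorm.

Section BUCComplete.
Context {X : CompleteNormedModule R_AbsRing}.

Lemma BUC_dist_bounded (u v : BUC X) : exists D, forall t, norm (minus (u t) (v t)) <= D.
Proof.
destruct (BUC_bounded u) as [M HM]. destruct (BUC_bounded v) as [N HN].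
exists (M + N). intros t. eapply Rle_trans; [apply norm_minus_le|].
now apply Rplus_le_compat.
Qed.

(** A general filter serves both limits, [lambda -> 0+] and [n -> oo]. The pointwise limits inherit
    the uniform Cauchy estimate by letting [j] run along the filter. *)
Lemma BUC_complete {I : Type} (F : (I -> Prop) -> Prop) {FF : ProperFilter F}
    (f : I -> BUC X) :
  (forall eps : posreal, exists P, F P /\
     forall i j, P i -> P j -> forall t, norm (minus (f i t) (f j t)) <= eps) ->
  exists v : BUC X, unif_limit F (fun i => BUC_fun (f i)) v.
Proof.
intros HC.
assert (Hpt : forall t, exists y : X, filterlim (fun i => f i t) F (locally y)).
{ intros t. apply (filterlim_locally_cauchy (U := X) (F := F) (fun i => f i t)). intros eps.
  destruct (HC (pos_div_2 eps)) as [P [HP HPij]]. exists P. split; [assumption|].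
  intros i j Hi Hj. apply (norm_compat1 (K := R_AbsRing) (V := X)).
  eapply Rle_lt_trans; [apply HPij; assumption|]. simpl. generalize (cond_pos eps). lra. }
set (g := fun t => proj1_sig (constructive_indefinite_description _ (Hpt t))).
assert (Hg : forall t, filterlim (fun i => f i t) F (locally (g t)))
  by (intros t; exact (proj2_sig (constructive_indefinite_description _ (Hpt t)))).
assert (Hle : forall eps : posreal, F (fun i => forall t, norm (minus (f i t) (g t)) <= eps)).
{ intros eps. destruct (HC eps) as [P [HP HPij]].
  apply filter_imp with P; [|assumption]. intros i Hi t. apply Rle_of_eps. intros e.
  assert (Hj : F (fun j => P j /\ norm (minus (f j t) (g t)) < e)).
  { apply filter_and; [assumption|].
    exact (proj2 (filterlim_norm_minus (F := F) (fun j => f j t) (g t)) (Hg t) e). }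
  destruct (filter_ex _ Hj) as [j [HPj Hjt]].
  eapply Rle_trans; [apply norm_minus_triangle with (y := f j t)|].
  apply Rplus_le_compat; [now apply HPij|lra]. }
assert (Hbd : bounded_fun g).
{ destruct (filter_ex _ (Hle (mkposreal 1 Rlt_0_1))) as [i Hi]. simpl in Hi.
  destruct (BUC_bounded (f i)) as [M HM]. exists (1 + M). intros t.
  eapply Rle_trans; [apply norm_le_minus with (y := f i t)|].
  rewrite norm_minus_sym. now apply Rplus_le_compat. }
assert (Huc : unif_continuous_fun (fun t : R => t) g).
{ intros eps.
  assert (He : 0 < eps / 3) by (generalize (cond_pos eps); lra).
  destruct (filter_ex _ (Hle (mkposreal _ He))) as [i Hi]. simpl in Hi.
  destruct (BUC_unif_continuous (f i) (mkposreal _ He)) as [delta Hd].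
  exists delta. intros s s' Hs. specialize (Hd s s' Hs). simpl in Hd.
  generalize (norm_minus_triangle (g s') (f i s') (g s))
    (norm_minus_triangle (f i s') (f i s) (g s)) (Hi s) (Hi s').
  rewrite (norm_minus_sym (g s') (f i s')). lra. }
exists (mkBUC Hbd Huc). intros eps.
apply filter_imp with (2 := Hle (pos_div_2 eps)). intros i Hi t.
eapply Rle_lt_trans; [apply Hi|]. simpl. generalize (cond_pos eps). lra.
Qed.

Lemma iter_contraction (Phi : BUC X -> BUC X) (q D : R) (u v : BUC X) :
  (forall (u v : BUC X) (D : R), (forall t, norm (minus (u t) (v t)) <= D) ->
     forall t, norm (minus (Phi u t) (Phi v t)) <= q * D) ->
  (forall t, norm (minus (u t) (v t)) <= D) ->
  forall n t, norm (minus (Nat.iter n Phi u t) (Nat.iter n Phi v t)) <= q ^ n * D.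
Proof.
intros HPhi HD n. induction n as [|n IH]; intros t; simpl.
- rewrite Rmult_1_l. apply HD.
- rewrite Rmult_assoc. now apply HPhi.
Qed.

(** Banach's fixed point theorem, with equality in [BUC] read pointwise. Convergence from every
    starting point is included because [is_solution] quantifies over all of them. *)
Lemma BUC_contraction (Phi : BUC X -> BUC X) (q : R) :
  0 <= q < 1 ->
  (forall (u v : BUC X) (D : R), (forall t, norm (minus (u t) (v t)) <= D) ->
     forall t, norm (minus (Phi u t) (Phi v t)) <= q * D) ->
  exists u : BUC X, (forall t, Phi u t = u t) /\
    forall psi, unif_limit eventually (fun n => BUC_fun (Nat.iter n Phi psi)) u.
Proof.
intros Hq HPhi.
assert (Hpow : forall (D : R) (eps : posreal), 0 <= D ->
  eventually (fun n => q ^ n * D < eps)).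
{ intros D eps HD.
  assert (He : 0 < eps / (D + 1)) by (apply Rdiv_lt_0_compat; [apply cond_pos|lra]).
  destruct (pow_lt_1_zero q ltac:(rewrite Rabs_pos_eq; lra) _ He) as [N HN].
  exists N. intros n Hn. specialize (HN n Hn). apply Rabs_def2 in HN.
  assert (Hqn : 0 <= q ^ n) by (apply pow_le; lra).
  assert (Hed : eps / (D + 1) * (D + 1) = eps) by (field; lra).
  nra. }
set (x0 := BUC_const zero : BUC X). set (x := fun n => Nat.iter n Phi x0).
destruct (BUC_dist_bounded (Phi x0) x0) as [D0 HD0].
assert (HD0p : 0 <= D0)
  by (eapply Rle_trans; [apply (norm_ge_0 (K := R_AbsRing) (V := X))|exact (HD0 0)]).
(* [D] solves [D = q * D + D0], so the ball of radius [D] about [x0] contains the whole orbit. *)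
set (D := D0 / (1 - q)).
assert (HD : D = q * D + D0) by (unfold D; field; lra).
assert (HDp : 0 <= D) by (apply Rdiv_le_0_compat; lra).
assert (Horb : forall k t, norm (minus (x k t) (x0 t)) <= D).
{ induction k as [|k IH]; intros t.
  - unfold x. simpl. rewrite norm_minus_self. assumption.
  - rewrite HD. eapply Rle_trans; [apply norm_minus_triangle with (y := Phi x0 t)|].
    apply Rplus_le_compat; [|apply HD0]. now apply (HPhi (x k) x0 D). }
(* Both points are [n]-th iterates, of [x k] and of [x0]. *)
assert (Hxx : forall n k t, norm (minus (x (n + k)%nat t) (x n t)) <= q ^ n * D).
{ intros n k t. unfold x. rewrite Nat.iter_add.
  apply iter_contraction; [assumption|]. apply Horb. }
destruct (@BUC_complete nat eventually _ x) as [u Hu].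
{ intros eps. destruct (Hpow D (pos_div_2 eps) HDp) as [N HN].
  exists (fun n => (N <= n)%nat). split; [exists N; auto|].
  intros i j Hi Hj t. specialize (HN N (le_n N)). simpl in HN.
  eapply Rle_trans; [apply norm_minus_triangle with (y := x N t)|].
  rewrite (norm_minus_sym (x N t)).
  generalize (Hxx N (i - N)%nat t) (Hxx N (j - N)%nat t).
  replace (N + (i - N))%nat with i by lia. replace (N + (j - N))%nat with j by lia.
  lra. }
assert (Hfix : forall t, Phi u t = u t).
{ intros t. apply eq_of_norm_minus_le0. apply Rle_of_eps. intros eps.
  destruct (Hu (pos_div_2 eps)) as [N HN].
  assert (H1 : norm (minus (Phi u t) (x (S N) t)) <= q * (eps / 2)).
  { apply (HPhi u (x N)). intros s. rewrite norm_minus_sym. left. apply (HN N (le_n N)). }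
  assert (H2 := HN (S N) (Nat.le_succ_diag_r N) t). simpl in H2.
  generalize (norm_minus_triangle (Phi u t) (x (S N) t) (u t)) (cond_pos eps).
  simpl in *. nra. }
exists u. split; [assumption|]. intros psi eps.
destruct (BUC_dist_bounded psi u) as [E HE].
assert (HEp : 0 <= E)
  by (eapply Rle_trans; [apply (norm_ge_0 (K := R_AbsRing) (V := X))|exact (HE 0)]).
apply filter_imp with (2 := Hpow E eps HEp). intros n Hn t.
eapply Rle_lt_trans; [|exact Hn]. clear Hn. revert t.
induction n as [|n IH]; intros t; simpl.
- rewrite Rmult_1_l. apply HE.
- rewrite Rmult_assoc, <- (Hfix t). now apply HPhi.
Qed.

Lemma BUC_ex_RInt (u : BUC X) (a b : R) : ex_RInt u a b.
Proof.
apply (ex_RInt_continuous (V := X)). intros z _. apply continuous_norm_minus. intros eps.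
destruct (BUC_unif_continuous u eps) as [delta Hd]. exists delta. intros s. apply Hd.
Qed.

(** The approximation is the mean of [psi] over [[t, t + h]], with [h] below the [delta] that
    uniform continuity assigns to [eps]. *)
Lemma BUC_lipschitz_dense (psi : BUC X) (eps : posreal) :
  exists (phi : BUC X) (L : R),
    (forall s t, norm (minus (phi s) (phi t)) <= L * Rabs (s - t)) /\
    forall t, norm (minus (phi t) (psi t)) <= eps.
Proof.
destruct (BUC_bounded psi) as [M HM].
destruct (BUC_unif_continuous psi eps) as [[delta Hdelta] Hd]. simpl in Hd.
set (h := delta / 2). assert (Hh : 0 < h < delta) by (unfold h; lra).
assert (Hih : 0 < / h) by (apply Rinv_0_lt_compat; lra).
set (phi := fun t => scal (/ h) (RInt psi t (t + h)) : X).
assert (HL : forall s t, norm (minus (phi s) (phi t)) <= / h * (2 * M) * Rabs (s - t)).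
{ intros s t. unfold phi. rewrite Rmult_assoc.
  (* By additivity only the integrals between the two left ends and between the two right ends
     remain, each at most [M * Rabs (s - t)]. *)
  apply norm_le_eq with (scal (/ h) (minus (RInt psi (t + h) (s + h)) (RInt psi t s))).
  - assert (E : plus (RInt psi t s) (RInt psi s (s + h))
              = plus (RInt psi t (t + h)) (RInt psi (t + h) (s + h))).
    { transitivity (RInt psi t (s + h)); [|symmetry];
        apply (RInt_Chasles (V := X) psi); apply BUC_ex_RInt. }
    apply (f_equal (fun y => scal (/ h) (minus y (plus (RInt psi t s) (RInt psi t (t + h)))))) in E.
    etransitivity; [|etransitivity; [exact E|]];
      module_eq (RInt psi t s :: RInt psi s (s + h) :: RInt psi t (t + h)
        :: RInt psi (t + h) (s + h) :: nil); ring.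
  - apply norm_scal_le; [lra|].
    eapply Rle_trans; [apply norm_minus_le|].
    replace (2 * M * Rabs (s - t)) with (Rabs (s + h - (t + h)) * M + Rabs (s - t) * M)
      by (replace (s + h - (t + h)) with (s - t) by ring; ring).
    apply Rplus_le_compat; apply (norm_RInt_le_const_abs (V := X) psi);
      auto; apply (RInt_correct (V := X)), BUC_ex_RInt. }
assert (Hpsi : forall t, norm (minus (phi t) (psi t)) <= eps).
{ intros t. unfold phi.
  assert (Hc : norm (minus (RInt psi t (t + h)) (scal (t + h - t) (psi t))) <= (t + h - t) * eps).
  { apply (norm_RInt_le_const (V := X) (fun s => minus (psi s) (psi t)) t (t + h)); [lra| |].
    - intros s Hs. left. apply Hd. rewrite Rabs_pos_eq; lra.
    - apply (is_RInt_minus (V := X) psi (fun _ => psi t)).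
      + apply (RInt_correct (V := X)), BUC_ex_RInt.
      + apply (is_RInt_const (V := X)). }
  apply norm_le_eq with (scal (/ h) (minus (RInt psi t (t + h)) (scal (t + h - t) (psi t)))).
  - module_eq (RInt psi t (t + h) :: psi t :: nil); field; lra.
  - eapply Rle_trans; [apply norm_scal_le; [lra|exact Hc]|]. right. field. lra. }
assert (Hb : bounded_fun phi).
{ exists (eps + M). intros t.
  eapply Rle_trans; [apply norm_le_minus with (y := psi t)|]. now apply Rplus_le_compat. }
exists (mkBUC Hb (lipschitz_unif_continuous HL)), (/ h * (2 * M)).
split; assumption.
Qed.

End BUCComplete.

(** * The approximate problems *)

(** The inequality common to both control conditions; the uniformly continuous
    condition is the case [g = 0]. *)
Definition control_inequality {X : CompleteNormedModule R_AbsRing} {d : delay}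
    (A : R -> history X d -> X -> X -> Prop) (g h k : R -> X) (K0 : R) (L1 L2 : R -> R) :
    Prop :=
  forall lambda t1 t2 (phi1 phi2 : history X d) x1 y1 x2 y2,
    0 < lambda -> A t1 phi1 x1 y1 -> A t2 phi2 x2 y2 ->
    norm (minus x1 x2)
    <= norm (minus (minus x1 x2) (scal lambda (minus y1 y2)))
       + lambda * norm (minus (h t1) (h t2)) * L1 (norm x2)
       + lambda * norm (minus (g t1) (g t2)) * norm y2
       + lambda * norm (minus (k t1) (k t2)) * L2 (sup_norm phi2)
       + K0 * lambda * sup_norm (fun s => minus (phi1 s) (phi2 s)).

Section Approximation.
Context {X : CompleteNormedModule R_AbsRing} {d : delay}.
Context (A : R -> history X d -> X -> X -> Prop) (omega : R).
Context (A_mdiss : forall t phi, m_dissipative (A t phi)) (omega_neg : omega < 0).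
Context (g h k : R -> X) (K0 Lg : R) (L1 L2 : R -> R).
Context (g_bounded : bounded_fun g)
  (g_lip : forall s t, norm (minus (g s) (g t)) <= Lg * Rabs (s - t))
  (h_bounded : bounded_fun h) (h_uc : unif_continuous_fun (fun t : R => t) h)
  (k_bounded : bounded_fun k) (k_uc : unif_continuous_fun (fun t : R => t) k)
  (Lg_ge0 : 0 <= Lg) (K0_pos : 0 < K0)
  (L1_gauge : control_gauge L1) (L2_gauge : control_gauge L2).
Context (A_control : control_inequality A g h k K0 L1 L2).

Let norm_nonneg (x : X) : 0 <= norm x := norm_ge_0 (K := R_AbsRing) (V := X) x.

(** Monotonicity of the gauges allows global bounds in place of the norms at one time. The base
    times [s1], [s2] of the histories are kept apart from the operator times [t1], [t2], so that
    periodicity can move the latter alone. *)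
Lemma control_segments (kappa t1 t2 s1 s2 M P D : R) (psi phi : BUC X) (x1 y1 x2 y2 : X) :
  0 < kappa ->
  A t1 (segment d psi s1) x1 y1 -> A t2 (segment d phi s2) x2 y2 ->
  norm x2 <= M -> (forall t, norm (phi t) <= P) ->
  (forall tau, norm (minus (psi (s1 + tau)) (phi (s2 + tau))) <= D) ->
  norm (minus x1 x2)
  <= norm (minus (minus x1 x2) (scal kappa (minus y1 y2)))
     + kappa * (norm (minus (h t1) (h t2)) * L1 M
                + norm (minus (g t1) (g t2)) * norm y2
                + norm (minus (k t1) (k t2)) * L2 P
                + K0 * D).
Proof.
intros Hk H1 H2 HM HP HD.
eapply Rle_trans; [exact (A_control Hk H1 H2)|].
assert (HL1 : L1 (norm x2) <= L1 M) by (apply L1_gauge; auto).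
assert (HP0 : 0 <= P) by (eapply Rle_trans; [apply norm_nonneg|exact (HP 0)]).
assert (HD0 : 0 <= D) by (eapply Rle_trans; [apply norm_nonneg|exact (HD 0)]).
assert (HL2 : L2 (sup_norm (segment d phi s2)) <= L2 P).
{ apply L2_gauge; [apply sup_norm_ge0|]. apply sup_norm_le; [assumption|].
  intros s. apply HP. }
assert (Hs : sup_norm (fun s => minus (segment d psi s1 s) (segment d phi s2 s)) <= D).
{ apply sup_norm_le; [assumption|]. intros s. apply HD. }
assert (E1 := Rmult_le_compat_l _ _ _ (norm_nonneg (minus (h t1) (h t2))) HL1).
assert (E2 := Rmult_le_compat_l _ _ _ (norm_nonneg (minus (k t1) (k t2))) HL2).
assert (E3 := Rmult_le_compat_l _ _ _ (Rlt_le _ _ K0_pos) Hs).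
apply (Rmult_le_compat_l kappa) in E1; [|lra].
apply (Rmult_le_compat_l kappa) in E2; [|lra].
apply (Rmult_le_compat_l kappa) in E3; [|lra].
lra.
Qed.

(** In the control inequality at two times the resolvent identity turns the first term on the right
    into [norm (z s - z t)]. Comparison with time 0 bounds [x], then [y = (x - z) / kappa] is
    bounded, and with these two bounds the moduli of [z], [psi], [g], [h], [k] yield one for [x]. *)
Lemma resolvent_BUC (kappa : R) (psi z : BUC X) :
  0 < kappa ->
  exists x : BUC X, forall t, exists y,
    A t (segment d psi t) (x t) y /\ z t = minus (x t) (scal kappa y).
Proof.
intros Hk.
assert (Hex : forall t, exists xy : X * X,
  A t (segment d psi t) (fst xy) (snd xy)
  /\ z t = minus (fst xy) (scal kappa (snd xy))).
{ intros t. destruct (A_mdiss t (segment d psi t)) as [_ Hr].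
  destruct (Hr kappa Hk (z t)) as [x [y Hxy]]. now exists (x, y). }
set (x := fun t => fst (proj1_sig (constructive_indefinite_description _ (Hex t)))).
set (y := fun t => snd (proj1_sig (constructive_indefinite_description _ (Hex t)))).
assert (Hxy : forall t, A t (segment d psi t) (x t) (y t)
                        /\ z t = minus (x t) (scal kappa (y t))).
{ intros t. exact (proj2_sig (constructive_indefinite_description _ (Hex t))). }
assert (Hz : forall s t, minus (minus (x s) (x t)) (scal kappa (minus (y s) (y t)))
                         = minus (z s) (z t)).
{ intros s t. rewrite (proj2 (Hxy s)), (proj2 (Hxy t)).
  module_eq (x s :: x t :: y s :: y t :: nil); ring. }
destruct (BUC_bounded psi) as [P HP]. destruct (BUC_bounded z) as [N HN].
destruct g_bounded as [G HG]. destruct h_bounded as [H HH]. destruct k_bounded as [K HK].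
assert (HP0 : 0 <= P) by (eapply Rle_trans; [apply norm_nonneg|exact (HP 0)]).
assert (Hxb : exists M, 0 <= M /\ forall t, norm (x t) <= M).
{ set (M := norm (x 0) + (N + N) + kappa * ((H + H) * L1 (norm (x 0))
       + (G + G) * norm (y 0) + (K + K) * L2 P + K0 * (P + P))).
  assert (HM : forall t, norm (x t) <= M).
  { intros t. eapply Rle_trans; [apply norm_le_minus with (y := x 0)|].
    assert (Hc := @control_segments kappa t 0 t 0 (norm (x 0)) P (P + P) psi psi
      (x t) (y t) (x 0) (y 0) Hk (proj1 (Hxy t)) (proj1 (Hxy 0)) (Rle_refl _) HP).
    rewrite Hz in Hc.
    assert (Hpsi : forall tau, norm (minus (psi (t + tau)) (psi (0 + tau))) <= P + P).
    { intros tau. eapply Rle_trans; [apply norm_minus_le|]. now apply Rplus_le_compat. }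
    specialize (Hc Hpsi).
    assert (HL1 : 0 <= L1 (norm (x 0))) by (apply L1_gauge; apply norm_nonneg).
    assert (HL2 : 0 <= L2 P) by (apply L2_gauge; assumption).
    assert (E1 : norm (minus (h t) (h 0)) * L1 (norm (x 0)) <= (H + H) * L1 (norm (x 0))).
    { apply Rmult_le_compat_r; [assumption|].
      eapply Rle_trans; [apply norm_minus_le|]. now apply Rplus_le_compat. }
    assert (E2 : norm (minus (g t) (g 0)) * norm (y 0) <= (G + G) * norm (y 0)).
    { apply Rmult_le_compat_r; [apply norm_nonneg|].
      eapply Rle_trans; [apply norm_minus_le|]. now apply Rplus_le_compat. }
    assert (E3 : norm (minus (k t) (k 0)) * L2 P <= (K + K) * L2 P).
    { apply Rmult_le_compat_r; [assumption|].
      eapply Rle_trans; [apply norm_minus_le|]. now apply Rplus_le_compat. }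
    assert (E4 := Rplus_le_compat _ _ _ _ (Rplus_le_compat _ _ _ _ E1 E2) E3).
    apply (Rmult_le_compat_l kappa) in E4; [|lra].
    assert (Ez : norm (minus (z t) (z 0)) <= N + N).
    { eapply Rle_trans; [apply norm_minus_le|]. now apply Rplus_le_compat. }
    unfold M. lra. }
  exists M. split; [|assumption].
  eapply Rle_trans; [apply norm_nonneg|exact (HM 0)]. }
destruct Hxb as [M [HM0 HM]].
assert (Hyb : exists Y, 0 <= Y /\ forall t, norm (y t) <= Y).
{ exists (/ kappa * (M + N)).
  assert (HY : forall t, norm (y t) <= / kappa * (M + N)).
  { intros t. apply norm_le_eq with (scal (/ kappa) (minus (x t) (z t))).
    - rewrite (proj2 (Hxy t)). module_eq (x t :: y t :: nil); field; lra.
    - apply norm_scal_le; [left; now apply Rinv_0_lt_compat|].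
      eapply Rle_trans; [apply norm_minus_le|]. now apply Rplus_le_compat. }
  split; [|assumption]. eapply Rle_trans; [apply norm_nonneg|exact (HY 0)]. }
destruct Hyb as [Y [HY0 HY]].
assert (Hxuc : unif_continuous_fun (fun t : R => t) x).
{ intros eps.
  assert (He := cond_pos eps).
  assert (HL1 : 0 <= L1 M) by (apply L1_gauge; assumption).
  assert (HL2 : 0 <= L2 P) by (apply L2_gauge; assumption).
  (* If all five data vary by at most [eta], then [x] varies by at most [eta * Q], which is
     [eps / 2]. *)
  set (Q := 1 + kappa * (L1 M + Y + L2 P + K0)).
  assert (HQ0 : 0 <= L1 M + Y + L2 P + K0) by lra.
  assert (HQ : 0 < Q) by (unfold Q; nra).
  assert (Heta : 0 < eps / (2 * Q)) by (apply Rdiv_lt_0_compat; lra).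
  set (eta := mkposreal _ Heta).
  destruct (BUC_unif_continuous z eta) as [dz Hdz].
  destruct (BUC_unif_continuous psi eta) as [dp Hdp].
  destruct (h_uc eta) as [dh Hdh]. destruct (k_uc eta) as [dk Hdk].
  destruct (lipschitz_unif_continuous g_lip eta) as [dg Hdg].
  assert (Hd0 : 0 < Rmin dz (Rmin dp (Rmin dh (Rmin dk dg))))
    by (repeat apply Rmin_pos; apply cond_pos).
  exists (mkposreal _ Hd0). simpl. intros s s' Hs.
  assert (Hs1 := Rlt_le_trans _ _ _ Hs (Rmin_l _ _)).
  assert (Hs2 := Rlt_le_trans _ _ _ Hs (Rmin_r _ _)).
  assert (Hs3 := Rlt_le_trans _ _ _ Hs2 (Rmin_l _ _)).
  assert (Hs4 := Rlt_le_trans _ _ _ Hs2 (Rmin_r _ _)).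
  assert (Hs5 := Rlt_le_trans _ _ _ Hs4 (Rmin_l _ _)).
  assert (Hs6 := Rlt_le_trans _ _ _ Hs4 (Rmin_r _ _)).
  assert (Hs7 := Rlt_le_trans _ _ _ Hs6 (Rmin_l _ _)).
  assert (Hs8 := Rlt_le_trans _ _ _ Hs6 (Rmin_r _ _)).
  assert (Hc := @control_segments kappa s' s s' s M P eta psi psi (x s') (y s') (x s) (y s)
    Hk (proj1 (Hxy s')) (proj1 (Hxy s)) (HM s) HP).
  rewrite Hz in Hc.
  assert (Hpsi : forall tau, norm (minus (psi (s' + tau)) (psi (s + tau))) <= eta).
  { intros tau. left. apply Hdp. replace (s' + tau - (s + tau)) with (s' - s) by ring.
    assumption. }
  specialize (Hc Hpsi).
  specialize (Hdz s s' Hs1). specialize (Hdh s s' Hs5). specialize (Hdk s s' Hs7).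
  specialize (Hdg s s' Hs8).
  assert (E1 : norm (minus (h s') (h s)) * L1 M <= eta * L1 M)
    by (apply Rmult_le_compat_r; [assumption|lra]).
  assert (E2 : norm (minus (g s') (g s)) * norm (y s) <= eta * Y)
    by (apply Rmult_le_compat; try apply norm_nonneg; [lra|apply HY]).
  assert (E3 : norm (minus (k s') (k s)) * L2 P <= eta * L2 P)
    by (apply Rmult_le_compat_r; [assumption|lra]).
  assert (E4 := Rplus_le_compat _ _ _ _ (Rplus_le_compat _ _ _ _ E1 E2) E3).
  apply (Rmult_le_compat_l kappa) in E4; [|lra].
  assert (HQeta : eta * Q = eps / 2) by (simpl; field; lra).
  unfold Q in HQeta. lra. }
exists (@mkBUC X x (ex_intro _ M HM) Hxuc). intros t. exists (y t). apply Hxy.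
Qed.

(** [u] solves iff [u t = (1 - kappa A(t, psi_t))^-1 (kappa / lambda K u t)], where
    [K] is the past average and [kappa = 1 / (1/lambda - omega)]. *)
Lemma approx_exists (lambda : R) (psi : BUC X) :
  0 < lambda -> exists u : BUC X, solves_approx A omega lambda psi u.
Proof.
intros Hl.
set (kappa := lambda / (1 - lambda * omega)).
assert (Hlo : 0 < 1 - lambda * omega) by nra.
assert (Hk : 0 < kappa) by (apply Rdiv_lt_0_compat; lra).
assert (Hq : kappa / lambda = / (1 - lambda * omega)) by (unfold kappa; field; lra).
assert (Hq1 : 0 <= kappa / lambda < 1).
{ rewrite Hq. split.
  - left. now apply Rinv_0_lt_compat.
  - rewrite <- Rinv_1. apply Rinv_lt_contravar; nra. }
assert (Hz : forall u : BUC X, exists z : BUC X,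
  forall t, z t = scal (kappa / lambda) (past_average lambda u t)).
{ intros u.
  assert (Hb : bounded_fun (fun t => scal (kappa / lambda) (past_average lambda u t) : X)).
  { destruct (BUC_bounded u) as [M HM]. exists (kappa / lambda * M). intros t.
    apply norm_scal_le; [lra|]. now apply norm_past_average_le. }
  assert (Huc : unif_continuous_fun (fun t : R => t)
    (fun t => scal (kappa / lambda) (past_average lambda u t) : X)).
  { intros eps. destruct (BUC_unif_continuous u eps) as [delta Hd].
    exists delta. intros s s' Hs.
    apply Rle_lt_trans with (kappa / lambda * eps); [|generalize (cond_pos eps); nra].
    apply norm_le_eq with
      (scal (kappa / lambda) (minus (past_average lambda u s') (past_average lambda u s))).
    - module_eq (past_average lambda u s' :: past_average lambda u s :: nil); ring.
    - apply norm_scal_le; [lra|]. apply past_average_lipschitz; [assumption|].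
      intros tau. left. apply Hd. replace (s' - tau - (s - tau)) with (s' - s) by ring.
      assumption. }
  exists (mkBUC Hb Huc). reflexivity. }
assert (HPhi : forall u : BUC X, exists v : BUC X, forall t, exists y,
  A t (segment d psi t) (v t) y /\
  scal (kappa / lambda) (past_average lambda u t) = minus (v t) (scal kappa y)).
{ intros u. destruct (Hz u) as [z Hzu]. destruct (resolvent_BUC psi z Hk) as [x Hx].
  exists x. intros t. rewrite <- Hzu. apply Hx. }
set (Phi := fun u => proj1_sig (constructive_indefinite_description _ (HPhi u))).
assert (HPhi' : forall (u : BUC X) t, exists y,
  A t (segment d psi t) (Phi u t) y /\
  scal (kappa / lambda) (past_average lambda u t) = minus (Phi u t) (scal kappa y))
  by (intros u; exact (proj2_sig (constructive_indefinite_description _ (HPhi u)))).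
destruct (@BUC_contraction X Phi (kappa / lambda)) as [u [Hu _]]; [assumption| |].
(* Both values belong to the same operator [A t (segment d psi t)], so dissipativity makes the
   resolvent nonexpansive; the contraction factor comes from [kappa / lambda]. *)
- intros u v D HD t.
  destruct (HPhi' u t) as [y [Hy Ey]]. destruct (HPhi' v t) as [y' [Hy' Ey']].
  destruct (A_mdiss t (segment d psi t)) as [Hdiss _].
  eapply Rle_trans; [exact (Hdiss kappa _ _ _ _ Hk Hy Hy')|].
  apply norm_le_eq with
    (scal (kappa / lambda) (minus (past_average lambda u t) (past_average lambda v t))).
  + transitivity (minus (scal (kappa / lambda) (past_average lambda u t))
                        (scal (kappa / lambda) (past_average lambda v t))).
    * rewrite Ey, Ey'. module_eq (Phi u t :: Phi v t :: y :: y' :: nil); ring.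
    * module_eq (past_average lambda u t :: past_average lambda v t :: nil); ring.
  + apply norm_scal_le; [lra|]. apply past_average_lipschitz; [assumption|].
    intros tau. apply HD.
- exists u. intros t. destruct (HPhi' u t) as [y [Hy Ey]]. rewrite Hu in Hy, Ey.
  fold (drift omega lambda u t). rewrite drift_eq.
  apply (eq_ind y (A t (segment d psi t) (u t)) Hy).
  (* Solving the resolvent identity for [y] and using [1 / kappa = 1 / lambda - omega] gives the
     drift. *)
  transitivity (scal (/ kappa) (minus (u t) (scal (kappa / lambda) (past_average lambda u t)))).
  + rewrite Ey. module_eq (u t :: y :: nil); field; lra.
  + module_eq (u t :: past_average lambda u t :: nil); unfold kappa; field; lra.
Qed.

(** Once the shift is removed from the operator, both pairs are compared at the same time [t]; the
    terms in [g], [h], [k] vanish and only [K0 * D] remains. The case [c = 0] gives uniqueness and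
    Lipschitz dependence on [psi], the case of a period gives periodicity. *)
Lemma approx_shift_stable (lambda c D : R) (psi phi u v : BUC X) :
  0 < lambda ->
  (forall t phi x y, A (t + c) phi x y -> A t phi x y) ->
  solves_approx A omega lambda psi u -> solves_approx A omega lambda phi v ->
  (forall t, norm (minus (psi (t + c)) (phi t)) <= D) ->
  forall t, norm (minus (u (t + c)) (v t)) <= K0 / - omega * D.
Proof.
intros Hl HA Hu Hv HD t.
replace (K0 / - omega * D) with (K0 * D / - omega) by (field; lra).
apply comparison_shift with (lambda := lambda); [assumption|assumption|].
clear t. intros t kappa Hk.
destruct (BUC_bounded phi) as [P HP].
eapply Rle_trans.
- apply (@control_segments kappa t t (t + c) t (norm (v t)) P D psi phi
    (u (t + c)) (drift omega lambda u (t + c)) (v t) (drift omega lambda v t) Hk).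
  + apply HA. apply Hu.
  + apply Hv.
  + apply Rle_refl.
  + assumption.
  + intros tau. replace (t + c + tau) with (t + tau + c) by ring. apply HD.
- rewrite !norm_minus_self. right. ring.
Qed.

(** The solution is compared with a constant function [x0], where [[x0, y0]] lies in the operator at
    time 0. Nothing in [sigma] depends on [lambda]. *)
Lemma approx_bounded (psi : BUC X) :
  exists M, 0 <= M /\ forall lambda (u : BUC X), 0 < lambda ->
    solves_approx A omega lambda psi u -> forall t, norm (u t) <= M.
Proof.
destruct (A_mdiss 0 (segment d psi 0)) as [_ Hr].
destruct (Hr 1 Rlt_0_1 zero) as [x0 [y0 [Hxy0 _]]].
destruct (BUC_bounded psi) as [P HP].
destruct g_bounded as [G HG]. destruct h_bounded as [H HH]. destruct k_bounded as [K HK].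
assert (HP0 : 0 <= P) by (eapply Rle_trans; [apply norm_nonneg|exact (HP 0)]).
set (sigma := (H + H) * L1 (norm x0) + (G + G) * norm y0 + (K + K) * L2 P + K0 * (P + P)
  + (norm y0 + - omega * norm x0)).
assert (HM : forall lambda (u : BUC X), 0 < lambda ->
    solves_approx A omega lambda psi u -> forall t, norm (u t) <= sigma / - omega + norm x0).
{ intros lambda u Hl Hu t.
  eapply Rle_trans; [apply norm_le_minus with (y := x0)|]. apply Rplus_le_compat_r.
  rewrite <- (Rplus_0_r t).
  apply (@comparison_shift X omega lambda 0 sigma u (BUC_const x0)); [assumption|assumption|].
  clear t. intros t kappa Hk. simpl.
  eapply Rle_trans.
  { apply (@control_segments kappa (t + 0) 0 (t + 0) 0 (norm x0) P (P + P) psi psi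
      (u (t + 0)) (drift omega lambda u (t + 0)) x0 y0 Hk).
    - apply Hu.
    - assumption.
    - apply Rle_refl.
    - assumption.
    - intros tau. eapply Rle_trans; [apply norm_minus_le|]. now apply Rplus_le_compat. }
  assert (Hdc : drift omega lambda (fun _ => x0) t = scal (- omega) x0).
  { rewrite drift_eq. unfold past_average. rewrite exp_average_const by assumption.
    module_eq (x0 :: nil). ring. }
  rewrite Hdc.
  (* The constant has drift [- omega * x0] instead of [y0]; the discrepancy is the last summand of
     [sigma]. *)
  assert (E0 : norm (minus (minus (u (t + 0)) x0)
         (scal kappa (minus (drift omega lambda u (t + 0)) y0)))
    <= norm (minus (minus (u (t + 0)) x0)
         (scal kappa (minus (drift omega lambda u (t + 0)) (scal (- omega) x0))))
       + kappa * (norm y0 + - omega * norm x0)).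
  { apply norm_le_eq with (plus (minus (minus (u (t + 0)) x0)
         (scal kappa (minus (drift omega lambda u (t + 0)) (scal (- omega) x0))))
         (scal kappa (minus y0 (scal (- omega) x0)))).
    - module_eq (u (t + 0) :: x0 :: drift omega lambda u (t + 0) :: y0 :: nil); ring.
    - eapply Rle_trans; [apply (norm_triangle (K := R_AbsRing) (V := X))|].
      apply Rplus_le_compat_l. apply norm_scal_le; [lra|].
      eapply Rle_trans; [apply norm_minus_le|]. apply Rplus_le_compat_l.
      apply norm_scal_le; lra. }
  assert (HL1 : 0 <= L1 (norm x0)) by (apply L1_gauge; apply norm_nonneg).
  assert (HL2 : 0 <= L2 P) by (apply L2_gauge; assumption).
  assert (E1 : norm (minus (h (t + 0)) (h 0)) * L1 (norm x0) <= (H + H) * L1 (norm x0)).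
  { apply Rmult_le_compat_r; [assumption|].
    eapply Rle_trans; [apply norm_minus_le|]. now apply Rplus_le_compat. }
  assert (E2 : norm (minus (g (t + 0)) (g 0)) * norm y0 <= (G + G) * norm y0).
  { apply Rmult_le_compat_r; [apply norm_nonneg|].
    eapply Rle_trans; [apply norm_minus_le|]. now apply Rplus_le_compat. }
  assert (E3 : norm (minus (k (t + 0)) (k 0)) * L2 P <= (K + K) * L2 P).
  { apply Rmult_le_compat_r; [assumption|].
    eapply Rle_trans; [apply norm_minus_le|]. now apply Rplus_le_compat. }
  assert (E4 := Rplus_le_compat _ _ _ _ (Rplus_le_compat _ _ _ _ E1 E2) E3).
  apply (Rmult_le_compat_l kappa) in E4; [|lra].
  unfold sigma. lra. }
exists (Rmax 0 (sigma / - omega + norm x0)). split; [apply Rmax_l|].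
intros lambda u Hl Hu t. eapply Rle_trans; [exact (HM lambda u Hl Hu t)|apply Rmax_r].
Qed.

(** Each of the four error terms of the control inequality is put below [e / 4] plus a multiple of
    [(s - t) ^ 2], and [comparison_doubled] is read on the diagonal. The hypothesis on [Y] covers
    [g = 0] and the Lipschitz case together. *)
Lemma approx_cauchy (psi : BUC X) (Y : R) :
  (forall lambda (u : BUC X), 0 < lambda -> solves_approx A omega lambda psi u ->
     forall s t, norm (minus (g s) (g t)) * norm (drift omega lambda u t) <= Y * Rabs (s - t)) ->
  forall eps : posreal, exists delta : posreal,
    forall lambda mu (u v : BUC X), 0 < lambda < delta -> 0 < mu < delta ->
      solves_approx A omega lambda psi u -> solves_approx A omega mu psi v ->
      forall t, norm (minus (u t) (v t)) <= eps.
Proof.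
intros HY eps. assert (Heps := cond_pos eps).
destruct (approx_bounded psi) as [M [HM0 HM]].
destruct (BUC_bounded psi) as [P HP].
assert (HP0 : 0 <= P) by (eapply Rle_trans; [apply norm_nonneg|exact (HP 0)]).
assert (HL1 : 0 <= L1 M) by (apply L1_gauge; assumption).
assert (HL2 : 0 <= L2 P) by (apply L2_gauge; assumption).
(* Chosen so that [e / - omega] is half of [eps]; [delta] below makes the term with [lambda + mu] at
   most the other half. *)
set (e := eps * - omega / 2). assert (He : 0 < e) by (unfold e; nra).
assert (Hmod : forall (f : R -> X) (a : R), bounded_fun f ->
  unif_continuous_fun (fun t : R => t) f -> 0 <= a ->
  exists C, 0 <= C /\ forall s t, norm (minus (f s) (f t)) * a <= e / 4 + C * (s - t) ^ 2).
{ intros f a Hfb Hfu Ha.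
  destruct (quadratic_modulus Hfb Hfu (eps := e / (4 * (a + 1)))) as [C [HC0 HC]].
  - apply Rdiv_lt_0_compat; lra.
  - exists (C * a). split; [now apply Rmult_le_pos|]. intros s t.
    apply Rle_trans with ((e / (4 * (a + 1)) + C * (s - t) ^ 2) * a).
    + now apply Rmult_le_compat_r.
    + assert (e / (4 * (a + 1)) * (a + 1) = e / 4) by (field; lra).
      assert (0 < e / (4 * (a + 1))) by (apply Rdiv_lt_0_compat; lra).
      lra. }
destruct (Hmod h (L1 M) h_bounded h_uc HL1) as [C1 [HC1 Hh]].
destruct (Hmod k (L2 P) k_bounded k_uc HL2) as [C2 [HC2 Hk]].
destruct (Hmod psi K0 (BUC_bounded psi) (BUC_unif_continuous psi) (Rlt_le _ _ K0_pos))
  as [C3 [HC3 Hp]].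
(* The last summand comes from Young's inequality [Y * r <= e / 4 + Y ^ 2 / e * r ^ 2] for
   [r = Rabs (s - t)]. *)
set (C := C1 + C2 + C3 + Y ^ 2 / e).
assert (HYe : 0 <= Y ^ 2 / e) by (apply Rdiv_le_0_compat; [apply pow2_ge_0|assumption]).
assert (HC : 0 <= C) by (unfold C; lra).
assert (Ho2 : 0 < omega ^ 2) by nra.
assert (Hdelta : 0 < eps * omega ^ 2 / (8 * (C + 1)))
  by (apply Rdiv_lt_0_compat; [nra|lra]).
exists (mkposreal _ Hdelta). simpl. intros lambda mu u v Hl Hm Hu Hv t.
eapply Rle_trans.
- apply (@comparison_doubled X omega lambda mu e C u v);
    [assumption|apply Hl|apply Hm|lra|assumption|].
  clear t. intros s t kappa Hkap.
  eapply Rle_trans.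
  + apply (@control_segments kappa s t s t M P ((e / 4 + C3 * (s - t) ^ 2) / K0) psi psi
      (u s) (drift omega lambda u s) (v t) (drift omega mu v t) Hkap).
    * apply Hu.
    * apply Hv.
    * exact (HM mu v (proj1 Hm) Hv t).
    * assumption.
    * intros tau. apply Rmult_le_reg_r with K0; [assumption|].
      replace ((e / 4 + C3 * (s - t) ^ 2) / K0 * K0)
        with (e / 4 + C3 * (s + tau - (t + tau)) ^ 2) by (field; lra).
      apply Hp.
  + apply Rplus_le_compat_l. apply Rmult_le_compat_l; [lra|].
    replace (K0 * ((e / 4 + C3 * (s - t) ^ 2) / K0)) with (e / 4 + C3 * (s - t) ^ 2)
      by (field; lra).
    assert (E : Y * Rabs (s - t) <= e / 4 + Y ^ 2 / e * (s - t) ^ 2).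
    { apply Rmult_le_reg_l with e; [assumption|].
      replace (e * (e / 4 + Y ^ 2 / e * (s - t) ^ 2))
        with (e ^ 2 / 4 + Y ^ 2 * (s - t) ^ 2) by (field; lra).
      rewrite <- (pow2_abs (s - t)).
      generalize (pow2_ge_0 (e / 2 - Y * Rabs (s - t))). lra. }
    generalize (Hh s t) (Hk s t) (HY mu v (proj1 Hm) Hv s t). unfold C. lra.
- replace (t - t) with 0 by ring.
  assert (E1 : e / - omega = eps / 2) by (unfold e; field; lra).
  assert (E2 : 2 * (lambda + mu) / omega ^ 2 <= eps / (2 * (C + 1))).
  { apply Rmult_le_reg_r with (omega ^ 2); [assumption|].
    replace (2 * (lambda + mu) / omega ^ 2 * omega ^ 2) with (2 * (lambda + mu))
      by (field; lra).
    replace (eps / (2 * (C + 1)) * omega ^ 2)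
      with (4 * (eps * omega ^ 2 / (8 * (C + 1)))) by (field; lra).
    lra. }
  assert (E3 : C * (0 ^ 2 / - omega + 2 * (lambda + mu) / omega ^ 2)
               <= C * (eps / (2 * (C + 1)))).
  { apply Rmult_le_compat_l; [assumption|]. unfold Rdiv at 1. lra. }
  assert (E4 : (C + 1) * (eps / (2 * (C + 1))) = eps / 2) by (field; lra).
  assert (E5 : 0 < eps / (2 * (C + 1))) by (apply Rdiv_lt_0_compat; lra).
  lra.
Qed.

(** A bound [D] on the drift makes [u] Lipschitz with constant [(c + Lg * D) / - omega], by
    comparison with its translates; this constant in turn bounds the Yosida derivative. Since
    [Lg / - omega < 1], the bound improves itself. *)
Lemma drift_bounded (psi : BUC X) (Lh Lk Lp : R) :
  Lg < - omega ->
  (forall s t, norm (minus (h s) (h t)) <= Lh * Rabs (s - t)) ->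
  (forall s t, norm (minus (k s) (k t)) <= Lk * Rabs (s - t)) ->
  (forall s t, norm (minus (psi s) (psi t)) <= Lp * Rabs (s - t)) ->
  exists Y, forall lambda (u : BUC X), 0 < lambda -> solves_approx A omega lambda psi u ->
    forall t, norm (drift omega lambda u t) <= Y.
Proof.
intros HLg HLh HLk HLp.
destruct (approx_bounded psi) as [M [HM0 HM]].
destruct (BUC_bounded psi) as [P HP].
assert (HP0 : 0 <= P) by (eapply Rle_trans; [apply norm_nonneg|exact (HP 0)]).
assert (HL1 : 0 <= L1 M) by (apply L1_gauge; assumption).
assert (HL2 : 0 <= L2 P) by (apply L2_gauge; assumption).
set (c := Lh * L1 M + Lk * L2 P + K0 * Lp).
exists ((c / - omega + - omega * M) / (1 - Lg / - omega)).
intros lambda u Hl Hu.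
assert (HMu := HM lambda u Hl Hu).
(* This a priori bound blows up as [lambda -> 0], but it does not enter the resulting bound. *)
apply self_improving_bound with (B := / lambda * (M + M) + - omega * M)
  (f := fun t => norm (drift omega lambda u t)).
- split; [apply Rdiv_le_0_compat; lra|].
  apply Rmult_lt_reg_r with (- omega); [lra|].
  replace (Lg / - omega * - omega) with Lg by (field; lra). lra.
- intros t. apply norm_drift_le; try assumption; [|apply HMu].
  eapply Rle_trans; [apply norm_minus_le|]. apply Rplus_le_compat; [apply HMu|].
  now apply norm_past_average_le.
- intros D HD t.
  set (l := (c + Lg * D) / - omega).
  assert (Hlip : forall tau s, norm (minus (u (s + tau)) (u s)) <= l * Rabs tau).
  { intros tau s.
    replace (l * Rabs tau) with ((c + Lg * D) * Rabs tau / - omega) by (unfold l; field; lra).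
    apply comparison_shift with (lambda := lambda); [assumption|assumption|].
    clear s. intros s kappa Hk.
    eapply Rle_trans.
    - apply (@control_segments kappa (s + tau) s (s + tau) s M P (Lp * Rabs tau) psi psi
        (u (s + tau)) (drift omega lambda u (s + tau)) (u s) (drift omega lambda u s) Hk).
      + apply Hu.
      + apply Hu.
      + apply HMu.
      + assumption.
      + intros r. eapply Rle_trans; [apply HLp|].
        replace (s + tau + r - (s + r)) with tau by ring. lra.
    - apply Rplus_le_compat_l. apply Rmult_le_compat_l; [lra|].
      assert (Hst : s + tau - s = tau) by ring.
      generalize (HLh (s + tau) s) (HLk (s + tau) s) (g_lip (s + tau) s). rewrite Hst.
      intros Eh Ek Eg.
      apply (Rmult_le_compat_r (L1 M)) in Eh; [|assumption].
      apply (Rmult_le_compat_r (L2 P)) in Ek; [|assumption].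
      assert (Egd : norm (minus (g (s + tau)) (g s)) * norm (drift omega lambda u s)
                    <= Lg * Rabs tau * D)
        by (apply Rmult_le_compat; try apply norm_nonneg; auto).
      unfold c. lra. }
  eapply Rle_trans.
  + apply norm_drift_le with (D := l * lambda) (M := M); try assumption; [|apply HMu].
    rewrite norm_minus_sym.
    (* The exponential weight has mean [lambda], so a function with Lipschitz constant [l] differs
       from its past average by at most [l * lambda]. *)
    replace (l * lambda) with (0 + l * lambda + 2 * 0 * lambda ^ 2) by ring.
    apply past_average_dist_const; [assumption|]. intros tau Htau.
    generalize (Hlip (- tau) t). rewrite Rabs_Ropp, (Rabs_pos_eq tau) by assumption.
    unfold Rminus. lra.
  + right. unfold l. field. lra.
Qed.

End Approximation.

(** * The limit *)

Lemma at_right_0_interval (delta : posreal) : at_right 0 (fun x => 0 < x < delta).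
Proof.
exists delta. intros x Hx Hx0. split; [assumption|].
change (Rabs (x - 0) < delta) in Hx. apply Rabs_def2 in Hx. lra.
Qed.

Lemma at_right_0_pos : at_right 0 (fun x => 0 < x).
Proof. exists (mkposreal 1 Rlt_0_1). auto. Qed.

(** The passage to the limit uses only solvability, stability uniform in [lambda], and the Cauchy
    property for Lipschitz starting points, so it applies to either control condition. *)
Lemma periodic_solution_of_approximations {X : CompleteNormedModule R_AbsRing} {d : delay}
    (A : R -> history X d -> X -> X -> Prop) (omega q T : R) :
  0 <= q < 1 ->
  (forall lambda psi, 0 < lambda -> exists u, solves_approx A omega lambda psi u) ->
  (forall lambda c D (psi phi u v : BUC X), 0 < lambda -> c = 0 \/ c = T ->
     solves_approx A omega lambda psi u -> solves_approx A omega lambda phi v ->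
     (forall t, norm (minus (psi (t + c)) (phi t)) <= D) ->
     forall t, norm (minus (u (t + c)) (v t)) <= q * D) ->
  (forall (psi : BUC X) (L : R),
     (forall s t, norm (minus (psi s) (psi t)) <= L * Rabs (s - t)) ->
     forall eps : posreal, exists delta : posreal,
       forall lambda mu (u v : BUC X), 0 < lambda < delta -> 0 < mu < delta ->
         solves_approx A omega lambda psi u -> solves_approx A omega mu psi v ->
         forall t, norm (minus (u t) (v t)) <= eps) ->
  exists u : R -> X, is_solution A omega u /\ forall t, u (t + T) = u t.
Proof.
intros Hq Hex Hshift Hcauchy.
(* The solution operator is made total in [lambda], with the dummy value [psi] for [lambda <= 0]. *)
assert (Hex' : forall lambda psi, exists u : BUC X,
  0 < lambda -> solves_approx A omega lambda psi u).
{ intros lambda psi. destruct (Rlt_le_dec 0 lambda) as [Hl|Hl].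
  - destruct (Hex lambda psi Hl) as [u Hu]. now exists u.
  - exists psi. lra. }
set (S := fun lambda psi => proj1_sig (constructive_indefinite_description _ (Hex' lambda psi))).
assert (HS : forall lambda psi, 0 < lambda -> solves_approx A omega lambda psi (S lambda psi)).
{ intros lambda psi. exact (proj2_sig (constructive_indefinite_description _ (Hex' lambda psi))). }
assert (Hstable : forall lambda D (psi phi u v : BUC X), 0 < lambda ->
  solves_approx A omega lambda psi u -> solves_approx A omega lambda phi v ->
  (forall t, norm (minus (psi t) (phi t)) <= D) ->
  forall t, norm (minus (u t) (v t)) <= q * D).
{ intros lambda D psi phi u v Hl Hu Hv HD t. rewrite <- (Rplus_0_r t) at 1.
  apply Hshift with lambda psi phi; auto. intros s. now rewrite Rplus_0_r. }
assert (Hlim : forall psi : BUC X, exists v : BUC X,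
  unif_limit (at_right 0) (fun lambda => BUC_fun (S lambda psi)) v).
{ intros psi. apply (BUC_complete (F := at_right 0) (f := fun lambda => S lambda psi)).
  intros eps. assert (He := cond_pos eps).
  (* Replacing [psi] by a Lipschitz [phi] costs at most [eps / 4] at each of [lambda] and [mu]; the
     Cauchy estimate for [phi] takes the remaining [eps / 2]. *)
  assert (He4 : 0 < eps / 4) by lra.
  destruct (BUC_lipschitz_dense psi (mkposreal _ He4)) as [phi [L [HL Hphi]]].
  destruct (Hcauchy phi L HL (pos_div_2 eps)) as [delta Hd].
  exists (fun lambda => 0 < lambda < delta). split; [apply at_right_0_interval|].
  intros lambda mu Hl Hm t.
  assert (Hqe : q * (eps / 4) <= eps / 4) by nra.
  assert (Hclose : forall nu, 0 < nu -> norm (minus (S nu phi t) (S nu psi t)) <= q * (eps / 4)).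
  { intros nu Hnu. apply (Hstable nu (eps / 4) phi psi); auto. }
  generalize (norm_minus_triangle (S lambda psi t) (S lambda phi t) (S mu psi t))
    (norm_minus_triangle (S lambda phi t) (S mu phi t) (S mu psi t))
    (Hclose lambda (proj1 Hl)) (Hclose mu (proj1 Hm))
    (Hd lambda mu (S lambda phi) (S mu phi) Hl Hm (HS _ _ (proj1 Hl)) (HS _ _ (proj1 Hm)) t).
  rewrite (norm_minus_sym (S lambda psi t) (S lambda phi t)). simpl. lra. }
set (S0 := fun psi => proj1_sig (constructive_indefinite_description _ (Hlim psi))).
assert (HS0 : forall psi, unif_limit (at_right 0) (fun lambda => BUC_fun (S lambda psi)) (S0 psi)).
{ intros psi. exact (proj2_sig (constructive_indefinite_description _ (Hlim psi))). }
assert (HS0shift : forall c D (psi phi : BUC X), c = 0 \/ c = T ->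
  (forall t, norm (minus (psi (t + c)) (phi t)) <= D) ->
  forall t, norm (minus (S0 psi (t + c)) (S0 phi t)) <= q * D).
{ intros c D psi phi Hc HD t. apply Rle_of_eps. intros eps.
  destruct (filter_ex (F := at_right 0) _
    (filter_and _ _ at_right_0_pos
      (filter_and _ _ (HS0 psi (pos_div_2 eps)) (HS0 phi (pos_div_2 eps)))))
    as [lambda [Hl [H1 H2]]].
  generalize (norm_minus_triangle (S0 psi (t + c)) (S lambda psi (t + c)) (S0 phi t))
    (norm_minus_triangle (S lambda psi (t + c)) (S lambda phi t) (S0 phi t))
    (H1 (t + c)) (H2 t)
    (Hshift lambda c D psi phi (S lambda psi) (S lambda phi) Hl Hc (HS _ _ Hl) (HS _ _ Hl) HD t).
  rewrite (norm_minus_sym (S0 psi (t + c)) (S lambda psi (t + c))). simpl. lra. }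
destruct (@BUC_contraction X S0 q Hq) as [u [Hfix Hiter]].
{ intros u v D HD t. rewrite <- (Rplus_0_r t) at 1. apply HS0shift; [now left|].
  intros s. now rewrite Rplus_0_r. }
exists u. split.
- intros psi.
  exists (fun lambda n => Nat.iter n (S lambda) psi), (fun n => BUC_fun (Nat.iter n S0 psi)).
  split; [|split; [|apply Hiter]].
  + intros lambda Hl. split; [reflexivity|]. intros n. split; [now apply HS|].
    (* Uniqueness is stability for equal starting points, [D = 0]. *)
    intros v Hv t. apply eq_of_norm_minus_le0.
    eapply Rle_trans; [|right; apply (Rmult_0_r q)].
    apply (Hstable lambda 0 _ _ v _ Hl Hv (HS _ _ Hl)).
    intros s. rewrite norm_minus_self. lra.
  + induction n as [|n IH]; intros eps; simpl.
    * apply filter_imp with (2 := at_right_0_pos). intros lambda _ t.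
      rewrite norm_minus_self. apply cond_pos.
    * apply filter_imp with (2 := filter_and _ _ at_right_0_pos
        (filter_and _ _ (IH (pos_div_2 eps)) (HS0 (Nat.iter n S0 psi) (pos_div_2 eps)))).
      intros lambda [Hl [H1 H2]] t.
      eapply Rle_lt_trans;
        [apply norm_minus_triangle with (y := S lambda (Nat.iter n S0 psi) t)|].
      (* The argument of [S lambda] itself varies with [lambda]; the contraction factor, uniform in
         [lambda], controls this, and [H2] treats the fixed argument. *)
      assert (H3 : norm (minus (S lambda (Nat.iter n (S lambda) psi) t)
                           (S lambda (Nat.iter n S0 psi) t)) <= q * (eps / 2)).
      { apply (Hstable lambda (eps / 2) (Nat.iter n (S lambda) psi) (Nat.iter n S0 psi));
          auto. intros s. left. apply H1. }
      specialize (H2 t). simpl in H2. generalize (cond_pos eps). nra.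
- intros t. apply eq_of_norm_minus_le0.
  destruct (BUC_bounded u) as [M HM].
  replace 0 with (0 / (1 - q)) by (field; lra). revert t.
  (* As [u] is fixed by [S0], the shift estimate bounds the supremum of this function by [q] times
     itself, so it vanishes. *)
  apply self_improving_bound with (f := fun t => norm (minus (u (t + T)) (u t))) (B := M + M).
  + assumption.
  + intros t. eapply Rle_trans; [apply norm_minus_le|]. now apply Rplus_le_compat.
  + intros D HD t. rewrite <- (Hfix (t + T)), <- (Hfix t), Rplus_0_r.
    apply HS0shift; [now right|assumption].
Qed.

Lemma lipschitz_const_bound {X : CompleteNormedModule R_AbsRing} (f : R -> X) :
  lipschitz_fun f ->
  0 <= lipschitz_const f /\
  forall s t, norm (minus (f s) (f t)) <= lipschitz_const f * Rabs (s - t).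
Proof.
intros [L HL]. unfold lipschitz_const.
set (E := fun q => exists s t : R, s <> t /\ q = norm (minus (f s) (f t)) / Rabs (s - t)).
assert (HE : forall s t, s <> t -> 0 < Rabs (s - t))
  by (intros s t Hst; apply Rabs_pos_lt; lra).
destruct (Lub_Rbar_correct E) as [Hub Hlub].
assert (HubL : is_ub_Rbar E L).
{ intros q [s [t [Hst ->]]]. simpl. apply Rmult_le_reg_r with (Rabs (s - t)); [auto|].
  replace (norm (minus (f s) (f t)) / Rabs (s - t) * Rabs (s - t))
    with (norm (minus (f s) (f t))) by (field; generalize (HE s t Hst); lra).
  apply HL. }
assert (Hq : forall s t, s <> t ->
  Rbar_le (norm (minus (f s) (f t)) / Rabs (s - t)) (Lub_Rbar E)).
{ intros s t Hst. apply Hub. now exists s, t. }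
specialize (Hlub L HubL).
(* One difference quotient excludes [m_infty]; the bound [L] excludes [p_infty]. *)
assert (H10 := Hq 1 0 R1_neq_R0).
destruct (Lub_Rbar E) as [l| |]; simpl in *; try easy.
assert (Hn : forall x : X, 0 <= norm x)
  by (intros x; apply (norm_ge_0 (K := R_AbsRing) (V := X))).
split.
- eapply Rle_trans; [|exact H10]. apply Rdiv_le_0_compat; [apply Hn|apply HE; lra].
- intros s t. destruct (Req_dec s t) as [->|Hst].
  + rewrite norm_minus_self. unfold Rminus. rewrite Rplus_opp_r, Rabs_R0. lra.
  + assert (H := Hq s t Hst). assert (HR := HE s t Hst).
    apply (Rmult_le_compat_r (Rabs (s - t))) in H; [|lra].
    replace (norm (minus (f s) (f t)) / Rabs (s - t) * Rabs (s - t))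
      with (norm (minus (f s) (f t))) in H by (field; lra).
    assumption.
Qed.

(** * The two control conditions *)

Theorem theorem3p6 (X : CompleteNormedModule R_AbsRing) (omega : R) (d : delay)
    (A : R -> history X d -> X -> X -> Prop)
    (A_mdiss : forall t phi, m_dissipative (A t phi))
    (A_control :
      (exists (h k : R -> X) (K0 : R) (L1 L2 : R -> R),
         unif_continuous_control A h k K0 L1 L2 /\ K0 < - omega) \/
      (exists (g h k : R -> X) (K0 : R) (L1 L2 : R -> R),
         lipschitz_control A g h k K0 L1 L2 /\
         Rmax K0 (lipschitz_const g) < - omega))
    (T : R) (T_pos : 0 < T)
    (A_periodic : forall t phi x y, A (t + T) phi x y <-> A t phi x y) :
  exists u : R -> X, is_solution A omega u /\ forall t, u (t + T) = u t.
Proof.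
assert (HA : forall c, c = 0 \/ c = T -> forall t phi x y, A (t + c) phi x y -> A t phi x y).
{ intros c [->| ->] t phi x y.
  - now rewrite Rplus_0_r.
  - apply A_periodic. }
assert (Hq : forall K0, 0 < K0 -> K0 < - omega -> 0 <= K0 / - omega < 1).
{ intros K0 H0 H1. split; [apply Rdiv_le_0_compat; lra|].
  apply Rmult_lt_reg_r with (- omega); [lra|].
  replace (K0 / - omega * - omega) with K0 by (field; lra). lra. }
destruct A_control as [[h [k [K0 [L1 [L2 [Hctl HK0]]]]]]|[g [h [k [K0 [L1 [L2 [Hctl Hmax]]]]]]]].
- destruct Hctl as [[Hhb Hhu] [[Hkb Hku] [HK0p [HL1 [HL2 Hctl]]]]].
  assert (Homega : omega < 0) by lra.
  (* With [g = 0], Lipschitz constant 0, condition (i) takes the common form, and no bound on the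
     drift is required: [Y = 0] below. *)
  set (g := fun _ : R => zero : X).
  assert (Hg0 : forall s t, norm (minus (g s) (g t)) = 0) by (intros; apply norm_minus_self).
  assert (Hgb : bounded_fun g).
  { exists 0. intros s. right. apply (norm_zero (K := R_AbsRing) (V := X)). }
  assert (Hgl : forall s t, norm (minus (g s) (g t)) <= 0 * Rabs (s - t)).
  { intros s t. rewrite Hg0. lra. }
  assert (Hctl' : control_inequality A g h k K0 L1 L2).
  { intros lambda t1 t2 phi1 phi2 x1 y1 x2 y2 Hl H1 H2. rewrite Hg0.
    generalize (Hctl lambda t1 t2 phi1 phi2 x1 y1 x2 y2 Hl H1 H2). lra. }
  apply periodic_solution_of_approximations with (q := K0 / - omega); [auto| | |].
  + intros lambda psi Hl. eapply approx_exists with (g := g) (h := h) (k := k) (K0 := K0)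
      (L1 := L1) (L2 := L2); eassumption.
  + intros lambda c D psi phi u v Hl Hc Hu Hv HD.
    eapply approx_shift_stable with (g := g) (h := h) (k := k) (K0 := K0)
      (L1 := L1) (L2 := L2); try eassumption. now apply HA.
  + intros psi L HL. eapply approx_cauchy with (g := g) (h := h) (k := k) (K0 := K0)
      (L1 := L1) (L2 := L2) (Y := 0); try eassumption.
    intros lambda u Hl Hu s t. rewrite Hg0. lra.
- destruct Hctl as [[Hgb Hgl] [[Hhb [Lh HLh]] [[Hkb [Lk HLk]] [HK0p [HL1 [HL2 Hctl]]]]]].
  assert (HK0 := Rle_lt_trans _ _ _ (Rmax_l _ _) Hmax).
  assert (HLg := Rle_lt_trans _ _ _ (Rmax_r _ _) Hmax).
  assert (Homega : omega < 0) by lra.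
  destruct (lipschitz_const_bound Hgl) as [HLg0 HLgb].
  assert (Hhu := lipschitz_unif_continuous HLh).
  assert (Hku := lipschitz_unif_continuous HLk).
  apply periodic_solution_of_approximations with (q := K0 / - omega); [auto| | |].
  + intros lambda psi Hl. eapply approx_exists with (g := g) (h := h) (k := k) (K0 := K0)
      (L1 := L1) (L2 := L2); eassumption.
  + intros lambda c D psi phi u v Hl Hc Hu Hv HD.
    eapply approx_shift_stable with (g := g) (h := h) (k := k) (K0 := K0)
      (L1 := L1) (L2 := L2); try eassumption. now apply HA.
  + intros psi L HL.
    (* This is where the Lipschitz starting point and [lipschitz_const g < - omega] enter. *)
    assert (HY : exists Y, forall lambda (u : BUC X), 0 < lambda ->
      solves_approx A omega lambda psi u -> forall t, norm (drift omega lambda u t) <= Y)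
      by (eapply drift_bounded with (g := g) (h := h) (k := k) (K0 := K0)
      (L1 := L1) (L2 := L2); eassumption).
    destruct HY as [Y HY].
    eapply approx_cauchy with (g := g) (h := h) (k := k) (K0 := K0)
      (L1 := L1) (L2 := L2) (Y := lipschitz_const g * Y); try eassumption.
    intros lambda u Hl Hu s t.
    replace (lipschitz_const g * Y * Rabs (s - t))
      with (lipschitz_const g * Rabs (s - t) * Y) by ring.
    apply Rmult_le_compat; [apply (norm_ge_0 (K := R_AbsRing) (V := X))
      |apply (norm_ge_0 (K := R_AbsRing) (V := X))|apply HLgb|now apply (HY lambda u)].
Qed.
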